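(* There exists a universal constant $c_0>0$ such that the following holds. Let $n\ge 2$, let $0<\tau_1\le\dots\le\tau_n$ be the computation times of the workers in the fixed computation model, and consider any randomized method. Fix any $\varepsilon,L_{\max},R,\mu,\sigma^2>0$ such that $\mu<L_{\max}/(2n)$, $\varepsilon<0.01$ and $R>10$. For any time budget $$t\le c_0\left(\frac1n\sum_{i=1}^n\tau_i\right)\frac{\sigma^2}{\varepsilon n\mu^2}$$ there exist a dimension $d$, functions $f_1,\dots,f_n:\mathbb{R}^d\to\mathbb{R}$ with average $f=\frac1n\sum_{i=1}^n f_i$, stochastic gradients $\nabla f_i(\cdot;\cdot)$, and a starting point $x^0$ at distance at most $R$ from the closest minimizer of $f$, such that: (1) every $f_i$ is differentiable, $L_{\max}$-smooth and convex, and $f$ attains its minimum; (2) (weak and strong interpolation) for every $i\in[n]$, a point is a minimizer of $f$ if and only if it is a minimizer of $f_i$; (3) $f$ is $L_{\max}$-smooth and satisfies the Polyak-Łojasiewicz condition with parameter $\mu$; (4) the stochastic gradients are unbiased and $\sigma^2$-variance-bounded; (5) the method started at $x^0$ cannot find an $\varepsilon$-solution in terms of distances to the solution set within $t$ seconds, i.e., every (random) point $\bar x$ it produces within $t$ seconds satisfies $\mathbb{E}\left[\|\bar x-\bar x_*\|^2\right]>\varepsilon$, where $\bar x_*$ is the minimizer of $f$ closest to $\bar x$. (It is not required that the individual functions $f_i$ satisfy the Polyak-Łojasiewicz condition with parameter $\mu$.)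
   Context: $[n]=\{1,\dots,n\}$; $\|\cdot\|$ is the Euclidean norm. A function $g$ is $L$-smooth if $\|\nabla g(x)-\nabla g(y)\|\le L\|x-y\|$ for all $x,y$. Distributed setting: there are $n$ workers operating in parallel and asynchronously; worker $i$ has access only to stochastic gradients $\nabla f_i(x;\xi_i)$, $\xi_i\sim\mathcal{D}_i$, of $f_i$, each returned stochastic gradient using a fresh independent sample. Fixed computation model: worker $i$ computes one stochastic gradient at a time and each computation takes $\tau_i$ seconds, so by time $t$ worker $i$ has returned at most $\lfloor t/\tau_i\rfloor$ stochastic gradients. Randomized method: any procedure that, given a starting point, using its own internal randomness (independent of the gradient noise) and the stochastic gradients returned so far, adaptively decides at which points the workers compute stochastic gradients, and which outputs (random) points depending only on this information. A point is produced within $t$ seconds if it depends only on the internal randomness and on stochastic gradients returned by time $t$. Unbiased, $\sigma^2$-variance-bounded: $\mathbb{E}_{\xi_i}[\nabla f_i(x;\xi_i)]=\nabla f_i(x)$ and $\mathbb{E}_{\xi_i}[\|\nabla f_i(x;\xi_i)-\nabla f_i(x)\|^2]\le\sigma^2$ for all $x\in\mathbb{R}^d$, $i\in[n]$. Polyak-Łojasiewicz condition with parameter $\mu>0$ for a function $g$: $\|\nabla g(x)\|^2\ge 2\mu(g(x)-g^* )$ for all $x\in\mathbb{R}^d$, where $g^*$ is the finite optimal value of $g$.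
   Formalization: The method outputs at each time a finite number m of points, m not depending on the dimension, and these change only as gradients are returned; if it could output infinitely many points (e.g. x⁰ plus all rational vectors), ''every point it produces'' would be false. *)

(* Defs.v *)
From HB Require Import structures.
From mathcomp Require Import all_boot all_order all_algebra.
From mathcomp Require Import all_classical all_reals all_analysis.

Set Implicit Arguments.
Unset Strict Implicit.
Unset Printing Implicit Defensive.

Import Order.TTheory GRing.Theory Num.Theory.
Import numFieldNormedType.Exports.

Local Open Scope classical_set_scope.
Local Open Scope ring_scope.

(* 'rV[R]_d carries the sigma-algebra generated by its coordinates, i.e. the
   Borel sigma-algebra of R^d. *)
Definition rV_display (R : realType) (d : nat) : measure_display.
Proof. exact: default_measure_display. Qed.

Section measurable_rV.
Variables (R : realType) (d : nat).

Let coords : 'I_d -> 'rV[R]_d -> R := fun j x => x ord0 j.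

Let rV_set0 : g_sigma_preimage coords set0.
Proof. exact: sigma_algebra0. Qed.

Let rV_setC A : g_sigma_preimage coords A -> g_sigma_preimage coords (~` A).
Proof. exact: sigma_algebraC. Qed.

Let rV_bigcup (F : _^nat) : (forall i, g_sigma_preimage coords (F i)) ->
  g_sigma_preimage coords (\bigcup_i (F i)).
Proof. exact: sigma_algebra_bigcup. Qed.

HB.instance Definition _ := @isMeasurable.Build (rV_display R d)
  'rV[R]_d (g_sigma_preimage coords) rV_set0 rV_setC rV_bigcup.

End measurable_rV.

(* The library norm `|x| on 'rV[R]_d is the sup norm. *)
Definition norm2 (R : realType) (d : nat) (x : 'rV[R]_d) : R :=
  Num.sqrt (\sum_(j < d) x ord0 j ^+ 2).

Definition grad (R : realType) (d : nat) (g : 'rV[R]_d -> R) (x : 'rV[R]_d) :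
    'rV[R]_d :=
  \row_(j < d) 'D_(delta_mx ord0 j) g x.

Definition smooth (R : realType) (d : nat) (L : R) (g : 'rV[R]_d -> R) : Prop :=
  (forall x, differentiable g x) /\
  (forall x y, norm2 (grad g x - grad g y) <= L * norm2 (x - y)).

Definition minimizer (R : realType) (d : nat) (g : 'rV[R]_d -> R)
    (x : 'rV[R]_d) : Prop :=
  forall y, g x <= g y.

Definition PL (R : realType) (d : nat) (mu : R) (g : 'rV[R]_d -> R) : Prop :=
  has_inf (range g) /\
  (forall x, 2 * mu * (g x - inf (range g)) <= norm2 (grad g x) ^+ 2).

Definition average (R : realType) (n d : nat) (f : 'I_n -> 'rV[R]_d -> R)
    (x : 'rV[R]_d) : R :=
  n%:R^-1 * \sum_(i < n) f i x.

Definition closest_minimizer (R : realType) (d : nat) (g : 'rV[R]_d -> R)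
    (x z : 'rV[R]_d) : Prop :=
  minimizer g z /\ (forall w, minimizer g w -> norm2 (x - z) <= norm2 (x - w)).

(* The default value x is irrelevant when g is convex and continuous and attains
   its minimum: the closest minimizer then exists and is unique. *)
Definition proj_minimizer (R : realType) (d : nat) (g : 'rV[R]_d -> R)
    (x : 'rV[R]_d) : 'rV[R]_d :=
  xget x [set z | closest_minimizer g x z].

Section stochastic_gradients.
Local Open Scope ereal_scope.

Definition unbiased (R : realType) (n d : nat) (f : 'I_n -> 'rV[R]_d -> R)
    (dX : measure_display) (X : measurableType dX) (D : 'I_n -> probability X R)
    (g : 'I_n -> 'rV[R]_d -> X -> 'rV[R]_d) : Prop :=
  forall (i : 'I_n) (x : 'rV[R]_d) (j : 'I_d),
    (D i).-integrable setT (fun xi => (g i x xi ord0 j)%:E) /\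
    'E_(D i)[fun xi => g i x xi ord0 j] = (grad (f i) x ord0 j)%:E.

Definition variance_bounded (R : realType) (n d : nat)
    (f : 'I_n -> 'rV[R]_d -> R)
    (dX : measure_display) (X : measurableType dX) (D : 'I_n -> probability X R)
    (g : 'I_n -> 'rV[R]_d -> X -> 'rV[R]_d) (sigma2 : R) : Prop :=
  forall (i : 'I_n) (x : 'rV[R]_d),
    'E_(D i)[fun xi => (norm2 (g i x xi - grad (f i) x) ^+ 2)%R] <= sigma2%:E.

End stochastic_gradients.

(* An order [Some (delay, x)] makes the worker drop whatever it is doing or was
   planned to do, and start, [delay] seconds from now, the computation of a
   stochastic gradient at x; [None] leaves the worker alone. *)
Definition order_to_worker (R : realType) (d : nat) : Type := option (R * 'rV[R]_d).

(* Measurability of a partial map for the sigma-algebra of the disjoint union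
   of {None} and T'. *)
Definition measurable_partial d d' (T : measurableType d)
    (T' : measurableType d') (F : T -> option T') : Prop :=
  forall B : set T', measurable B -> measurable (F @^-1` (Some @` B)).

(* A randomized method for n workers in R^d. The arguments of [decide] and of
   [output] are the internal randomness, the starting point and the stochastic
   gradients returned so far, in the order of their return; which worker
   returned each of them, when, and at which point it was computed are
   determined by these data and the method itself. [decide] is consulted at time
   0 and after every return, the only times at which the information changes.
   The method outputs m points, each of which evolves with the information; m is
   meant to be the same in all dimensions, as constant outputs forming a fine
   grid (or enumerating a dense set) would find any solution. *)
Record randomized_method (R : realType) (n m d : nat) := RandomizedMethod {
  seed_display : measure_display;
  seed : measurableType seed_display;
  seed_law : probability seed R;
  decide : seed -> 'rV[R]_d -> seq 'rV[R]_d -> 'I_n -> order_to_worker R d;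
  output : 'I_m -> seed -> 'rV[R]_d -> seq 'rV[R]_d -> 'rV[R]_d;
  measurable_decide : forall (x0 : 'rV[R]_d) (k : nat) (i : 'I_n),
    measurable_partial
      (fun p : seed * k.-tuple 'rV[R]_d => decide p.1 x0 p.2 i);
  measurable_output : forall (x0 : 'rV[R]_d) (k : nat) (q : 'I_m),
    measurable_fun setT
      (fun p : seed * k.-tuple 'rV[R]_d => output q p.1 x0 p.2) }.

Section execution.
Variables (R : realType) (n d : nat).

(* [clock] is the time of the last return (0 at the beginning), [returned] the
   list of all returned gradients, [nreturned i] the number of those returned by
   worker i, and [job i] the start time and the point of the computation which
   worker i is performing or is planned to perform. *)
Record state := State {
  clock : R;
  returned : seq 'rV[R]_d;
  nreturned : 'I_n -> nat;
  job : 'I_n -> option (R * 'rV[R]_d) }.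

Definition initial_state : state := State 0 [::] (fun=> 0%N) (fun=> None).

Variables (tau : 'I_n -> R) (decision : seq 'rV[R]_d -> 'I_n -> order_to_worker R d).

(* [sample i k x] is the k-th (from 0) gradient returned by worker i when it is
   computed at x. *)
Variable sample : 'I_n -> nat -> 'rV[R]_d -> 'rV[R]_d.

Definition current_job (s : state) (i : 'I_n) : option (R * 'rV[R]_d) :=
  if decision (returned s) i is Some (delay, x)
  then Some (clock s + Num.max 0 delay, x) else job s i.

Definition finish_time (s : state) (i : 'I_n) : \bar R :=
  if current_job s i is Some (start, _) then (start + tau i)%:E else +oo%E.

(* Perform the earliest pending return, if it takes place by time T. Of several
   simultaneous returns one is performed at a time. *)
Definition next_return (T : R) (s : state) : state :=
  if [pick i | (finish_time s i <= T%:E)%E &&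
        [forall j, (finish_time s i <= finish_time s j)%E]] is Some i then
    if current_job s i is Some (start, x) then
      State (start + tau i)
        (rcons (returned s) (sample i (nreturned s i) x))
        (fun j => if j == i then (nreturned s j).+1 else nreturned s j)
        (fun j => if j == i then None else current_job s j)
    else s
  else s.

(* By time T worker i has returned at most floor (T / tau i) gradients, so that
   this many iterations perform all the returns that take place by time T. *)
Definition returned_by (T : R) : seq 'rV[R]_d :=
  returned (iter (\sum_(i < n) Num.truncn (T / tau i))
                 (next_return T) initial_state).

End execution.

(* U is the internal randomness and xi i k the sample used in the k-th gradient
   returned by worker i: U has law Q, xi i k has law D i, and all of them are
   mutually independent. *)
Definition independent_randomness (R : realType) (n : nat)
    (dO : measure_display) (Omega : measurableType dO) (P : probability Omega R)
    (dS : measure_display) (S : measurableType dS) (Q : probability S R)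
    (dX : measure_display) (X : measurableType dX) (D : 'I_n -> probability X R)
    (U : {RV P >-> S}) (xi : 'I_n -> nat -> {RV P >-> X}) : Prop :=
  forall (A : set S) (K : nat) (B : 'I_n -> 'I_K -> set X),
    measurable A -> (forall i k, measurable (B i k)) ->
    P ((U @^-1` A) `&` [set w | forall i (k : 'I_K), B i k (xi i k w)]) =
    (Q A * \big[*%E/1]_(i < n) \big[*%E/1]_(k < K) D i (B i k))%E.

(* The q-th point output at time T by the method M started at x0. *)
Definition output_at (R : realType) (n m d : nat) (tau : 'I_n -> R)
    (M : randomized_method R n m d) (X : Type)
    (g : 'I_n -> 'rV[R]_d -> X -> 'rV[R]_d) (x0 : 'rV[R]_d)
    (u : seed M) (xi : 'I_n -> nat -> X) (q : 'I_m) (T : R) : 'rV[R]_d :=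
  output q u x0
    (returned_by tau (decide u x0) (fun i k x => g i x (xi i k)) T).

Arguments output_at {R n m d} tau M {X} g x0 u xi q T.

(* Main.v *)
Require Import Defs.
From HB Require Import structures.
From mathcomp Require Import all_boot all_order all_algebra.
From mathcomp Require Import all_classical all_reals all_analysis.
From mathcomp Require Import measurable_realfun ring lra.

Set Implicit Arguments.
Unset Strict Implicit.
Unset Printing Implicit Defensive.

Import Order.TTheory GRing.Theory Num.Theory.
Import numFieldNormedType.Exports.
Local Open Scope classical_set_scope.
Local Open Scope ring_scope.

(* The coordinates of R^d form n blocks of size D, one per worker.  In block j
   the common minimizer is Delta_j times an unknown basis vector e_(kappa j), with
   Delta_j^2 proportional to tau_j and sum_j Delta_j^2 = 4 eps.  Every f_i is a
   quadratic centered there, with curvature n mu on its own block and a tiny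
   curvature delta on the others, so that f has curvature at least mu while
   worker i is essentially the only source of information about block i.

   The noise is multiplicative in the center only: a stochastic gradient equals
   h (x - w a) with a random w of mean 1, which is mostly 0 and then shows
   nothing about a.  A block of the center is shown with a probability p_i of
   order (n mu Delta_i)^2 / sigma^2, so worker i, which returns at most t / tau_i
   gradients, shows its block with probability at most t p_i / tau_i, a quantity
   that does not depend on i and is at most 1/8 for the time budget considered.

   As long as block j stays hidden, the run and hence all the points which the
   method may output by time t (finitely many, at most m per return) are
   independent of kappa j, and each of them is close to at most one of the D
   candidates Delta_j e_k.  For D large, averaging over kappa yields one kappa for
   which the expected squared distance of every output exceeds eps. *)

(** * Euclidean norm and separable quadratics *)

Section norm2.
Context {R : realType} {d : nat}.
Implicit Types x y : 'rV[R]_d.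

Lemma norm2_ge0 x : 0 <= norm2 x. Proof. exact: sqrtr_ge0. Qed.

Lemma sqr_norm2 x : norm2 x ^+ 2 = \sum_(j < d) x ord0 j ^+ 2.
Proof. by rewrite sqr_sqrtr// sumr_ge0// => j _; exact: sqr_ge0. Qed.

End norm2.

Section quadratic.
Context {R : realType} {d : nat}.
Implicit Types (h : 'I_d -> R) (a x y : 'rV[R]_d).

Definition quad h a x : R := \sum_j h j / 2 * (x ord0 j - a ord0 j) ^+ 2.

Lemma quad_term_diff (c b : R) (j : 'I_d) x :
  differentiable (fun y : 'rV[R]_d => c * (y ord0 j - b) ^+ 2 : R^o) x.
Proof.
have -> : (fun y : 'rV[R]_d => c * (y ord0 j - b) ^+ 2 : R^o) =
    c *: ((fun y : 'rV[R]_d => y ord0 j : R^o) - cst b) ^+ 2.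
  by apply/funext => y /=; rewrite !fctE.
apply: differentiableZ; apply: differentiableX; apply: differentiableB => //.
exact: differentiable_coord.
Qed.

Lemma is_derive_quad_term (c b : R) (j k : 'I_d) x :
  is_derive x (delta_mx ord0 k : 'rV[R]_d)
    (fun y : 'rV[R]_d => c / 2 * (y ord0 j - b) ^+ 2 : R^o)
    (c * (x ord0 j - b) * (j == k)%:R).
Proof.
have -> : (fun y : 'rV[R]_d => c / 2 * (y ord0 j - b) ^+ 2 : R^o) =
    (c / 2) *: ((fun y : 'rV[R]_d => y ord0 j : R^o) - cst b) ^+ 2.
  by apply/funext => y /=; rewrite !fctE.
have ? : is_derive x (delta_mx ord0 k : 'rV[R]_d)
    (fun y : 'rV[R]_d => y ord0 j : R^o) (j == k)%:R.
  apply: DeriveDef.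
    exact/diff_derivable/differentiable_coord.
  rewrite deriveE; last exact: differentiable_coord.
  (* The coordinate is packed as a linear map, so that its differential is itself. *)
  pose f0 (y : 'rV[R]_d) : R^o := y ord0 j.
  have f0L : linear f0 by move=> r u v; rewrite /f0 !mxE.
  pose fM := GRing.isLinear.Build _ _ _ _ f0 f0L.
  pose f : {linear 'rV[R]_d -> R^o} := HB.pack f0 fM.
  have -> : (fun y : 'rV[R]_d => y ord0 j : R^o) = f by [].
  rewrite diff_lin; last exact: coord_continuous.
  by rewrite /f /= /f0 mxE eqxx.
apply: is_derive_eq.
rewrite !fctE /= subr0 expr1 /GRing.scale /=.
by field.
Qed.

Lemma quad_differentiable h a x : differentiable (quad h a : _ -> R^o) x.
Proof.
rewrite (_ : quad h a = \sum_j (fun y => h j / 2 * (y ord0 j - a ord0 j) ^+ 2)).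
  by apply: differentiable_sum => j; exact: quad_term_diff.
by apply/funext => y; rewrite /quad fct_sumE.
Qed.

Lemma grad_quad h a x : grad (quad h a) x = \row_j (h j * (x ord0 j - a ord0 j)).
Proof.
apply/rowP => k; rewrite !mxE.
rewrite (_ : quad h a =
  \sum_j (fun y => h j / 2 * (y ord0 j - a ord0 j) ^+ 2)); last first.
  by apply/funext => y; rewrite /quad fct_sumE.
have /is_derive_sum H := fun j => is_derive_quad_term (h j) (a ord0 j) j k x.
rewrite (@derive_val _ _ _ _ _ _ _ H) (bigD1 k)//= eqxx mulr1 big1 ?addr0//.
by move=> j /negbTE ->; rewrite mulr0.
Qed.

Lemma smooth_quad (L : R) h a : (forall j, 0 <= h j <= L) -> smooth L (quad h a).
Proof.
move=> h0L; split => [x|x y]; first exact: quad_differentiable.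
have [L0|L0] := leP 0 L; last first.
  (* A negative [L] contradicts the hypothesis at every index, so there is no coordinate and both
     norms are sums over nothing. *)
  rewrite (_ : norm2 (x - y) = 0); last first.
    rewrite /norm2 big1 ?sqrtr0// => j _.
    by have := h0L j; lra.
  rewrite mulr0 /norm2 big1 ?sqrtr0// => j _.
  by have := h0L j; lra.
rewrite -(@ler_pXn2r _ 2)// ?nnegrE ?mulr_ge0 ?norm2_ge0//.
rewrite exprMn !sqr_norm2 mulr_sumr; apply: ler_sum => j _.
rewrite !grad_quad !mxE.
have -> : h j * (x ord0 j - a ord0 j) - h j * (y ord0 j - a ord0 j) =
  h j * (x ord0 j - y ord0 j) by ring.
by rewrite exprMn ler_wpM2r ?sqr_ge0// ler_pXn2r ?nnegrE//; case/andP: (h0L j).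
Qed.

Lemma convex_quad h a : (forall j, 0 <= h j) -> convex_function setT (quad h a).
Proof.
move=> h0 t x y _ _.
have t0 : 0 <= t%:num by [].
have t1 : t%:num <= 1 by [].
change (quad h a (t%:num *: (x : 'rV_d) + (1 - t%:num) *: (y : 'rV_d)) <=
  t%:num * quad h a x + (1 - t%:num) * quad h a y).
rewrite /quad !mulr_sumr -big_split/=; apply: ler_sum => j _.
rewrite !mxE.
set u := x ord0 j; set v := y ord0 j; set b := a ord0 j; set s := t%:num.
(* The convexity defect of a square is exactly [s * (1 - s) * (u - v) ^+ 2]. *)
have -> : s * (h j / 2 * (u - b) ^+ 2) + (1 - s) * (h j / 2 * (v - b) ^+ 2) =
  h j / 2 * (s * u + (1 - s) * v - b) ^+ 2 + h j / 2 * (s * (1 - s) * (u - v) ^+ 2).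
  by field.
rewrite lerDl mulr_ge0 ?divr_ge0// mulr_ge0 ?sqr_ge0// mulr_ge0// subr_ge0//.
Qed.

Lemma quad_ge0 h a x : (forall j, 0 <= h j) -> 0 <= quad h a x.
Proof.
by move=> h0; apply: sumr_ge0 => j _; rewrite mulr_ge0 ?sqr_ge0// divr_ge0.
Qed.

Lemma quad_center h a : quad h a a = 0.
Proof. by rewrite /quad big1// => j _; rewrite subrr expr0n mulr0. Qed.

Lemma minimizer_quad h a x : (forall j, 0 < h j) -> minimizer (quad h a) x <-> x = a.
Proof.
move=> h0; have h0' j : 0 <= h j by exact: ltW.
split=> [xmin|-> y]; last by rewrite quad_center quad_ge0.
have := xmin a; rewrite quad_center => qx0.
have /eqP : quad h a x == 0 by rewrite eq_le qx0 quad_ge0.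
move=> /psumr_eq0P H; apply/rowP => j.
have /eqP := H (fun i _ => mulr_ge0 (divr_ge0 (h0' i) (ler0n _ 2)) (sqr_ge0 _)) j isT.
rewrite mulf_eq0 mulf_eq0 gt_eqF//= invr_eq0 pnatr_eq0/= sqrf_eq0 subr_eq0.
by move=> /eqP.
Qed.

(** The infimum is 0, attained at the center, and the inequality holds coordinate by coordinate
    because [mu * h j <= h j ^+ 2]. *)
Lemma PL_quad (mu : R) h a : 0 < mu -> (forall j, mu <= h j) -> PL mu (quad h a).
Proof.
move=> mu0 muh; have h0 j : 0 <= h j by rewrite (le_trans _ (muh j))// ltW.
have lb0 : lbound (range (quad h a)) 0 by move=> _ [x _ <-]; exact: quad_ge0.
have hinf : has_inf (range (quad h a)).
  by split; [exists (quad h a a), a|exists 0].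
split=> [//|x].
have -> : inf (range (quad h a)) = 0.
  apply/eqP; rewrite eq_le; apply/andP; split.
    by apply: ge_inf; [case: hinf|exists a => //; exact: quad_center].
  by apply: lb_le_inf => //; case: hinf.
rewrite subr0 sqr_norm2 mulr_sumr; apply: ler_sum => j _.
rewrite grad_quad mxE exprMn mulrA ler_wpM2r ?sqr_ge0//.
have -> : 2 * mu * (h j / 2) = mu * h j by field.
by rewrite expr2 ler_wpM2r.
Qed.

Lemma closest_minimizer_quad h a x z : (forall j, 0 < h j) ->
  closest_minimizer (quad h a) x z <-> z = a.
Proof.
move=> h0; split=> [[/minimizer_quad] -> //|->].
split=> [|w]; first exact/minimizer_quad.
by move/minimizer_quad => ->.
Qed.

(** The center is the only minimizer, hence the closest one from every point, and the default value
    of [xget] is never reached. *)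
Lemma proj_minimizer_quad h a x : (forall j, 0 < h j) ->
  proj_minimizer (quad h a) x = a.
Proof.
move=> h0; rewrite /proj_minimizer.
have [z|/(_ a)[]] := xgetP; last exact/closest_minimizer_quad.
by move=> _ /closest_minimizer_quad ->.
Qed.

End quadratic.

(** * Probability laws on [nat] with finite support *)

Section finite_law.
Context {R : realType} {N : nat} {w : nat -> R}.
Hypothesis w0 : forall k, 0 <= w k.
Hypothesis w1 : \sum_(k < N) w k = 1.

(* The mention of w1 lets the canonical probability instance find it. *)
Definition finite_law : set nat -> \bar R :=
  let _ := w1 in msum (fun k => mscale (NngNum (w0 k)) (dirac k)) N.

HB.instance Definition _ := Measure.on finite_law.

Lemma finite_lawE (A : set nat) :
  finite_law A = (\sum_(k < N) w k * (\1_A k))%:E.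
Proof.
by rewrite /finite_law /msum/= -sumEFin; apply: eq_bigr => k _; rewrite EFinM.
Qed.

Lemma finite_law_setT : finite_law setT = 1%E.
Proof.
rewrite finite_lawE -w1; congr EFin; apply: eq_bigr => k _.
by rewrite indicT mulr1.
Qed.

HB.instance Definition _ :=
  Measure_isProbability.Build _ _ _ finite_law finite_law_setT.

Lemma ge0_integral_finite_law (f : nat -> \bar R) : (forall k, 0 <= f k)%E ->
  (\int[finite_law]_k f k = \sum_(k < N) (w k)%:E * f k)%E.
Proof.
move=> f0; rewrite ge0_integral_measure_sum//; apply: eq_bigr => k _.
by rewrite ge0_integral_mscale//= integral_dirac//= diracT mul1e.
Qed.

Lemma integrable_finite_law (f : nat -> R) :
  (finite_law : {measure set nat -> \bar R}).-integrable setT (EFin \o f).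
Proof.
apply/integrableP; split=> //.
rewrite ge0_integral_finite_law => [|k]; last exact: abse_ge0.
by under eq_bigr do rewrite /= -EFinM; rewrite sumEFin ltry.
Qed.

Lemma expectation_finite_law (f : nat -> R) :
  ('E_(finite_law : probability nat R)[f] = (\sum_(k < N) w k * f k)%R%:E)%E.
Proof.
rewrite unlock integralE !ge0_integral_finite_law;
  [|exact: funeneg_ge0|exact: funepos_ge0].
have E (g : nat -> R) :
    (\sum_(k < N) (w k)%:E * (g k)%:E = (\sum_(k < N) w k * g k)%:E)%E.
  by rewrite -sumEFin; apply: eq_bigr => k _; rewrite EFinM.
rewrite (funerpos f) (funerneg f) !E -EFinB -sumrB; congr EFin.
apply: eq_bigr => k _; rewrite -mulrBr; congr (_ * _).
by rewrite -[in RHS](funrposBneg f).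
Qed.

End finite_law.

(** * Coordinatewise measurability in R^d *)

Section measurable_rV.
Context d (T : measurableType d) (R : realType) (m : nat).

Lemma measurable_coord (j : 'I_m) :
  measurable_fun setT (fun x : 'rV[R]_m => x ord0 j).
Proof.
move=> _ Y mY; rewrite setTI; apply: sub_sigma_algebra => /=.
rewrite -bigcup_seq/=; exists j => /=; first by rewrite mem_index_enum.
by exists Y => //; rewrite setTI.
Qed.

Lemma measurable_fun_rVP (f : T -> 'rV[R]_m) :
  measurable_fun setT f <->
  forall j, measurable_fun setT (fun x => f x ord0 j).
Proof.
split=> [mf j|mf _ Y].
  exact: (@measurableT_comp _ _ _ _ _ _ _ _ _ (measurable_coord j)).
rewrite setTI; move: Y.
(* The sets with a measurable preimage form a sigma-algebra, so it suffices that it contains the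
   generators. *)
apply: (@smallest_sub _ _ _ [set Y | measurable (f @^-1` Y)]).
  split=> /=.
  - by rewrite preimage_set0.
  - by move=> Y mY; rewrite setTD; rewrite preimage_setC; exact: measurableC.
  - by move=> F mF; rewrite preimage_bigcup; exact: bigcupT_measurable.
rewrite -bigcup_seq => Y [j _ [B mB <-]] /=; rewrite setTI.
by have := mf j measurableT B mB; rewrite setTI.
Qed.

End measurable_rV.

(** * Stochastic gradients with a noisy center *)

Section oracle.
Context {R : realType} {d : nat}.
Implicit Types (h : 'I_d -> R) (a x : 'rV[R]_d) (wt : 'I_d -> nat -> R).

(* The noise multiplies the center only: when wt vanishes, the oracle does not
   depend on a. *)
Definition oracle h a wt x (xi : nat) : 'rV[R]_d :=
  \row_b (h b * (x ord0 b - wt b xi * a ord0 b)).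

Lemma measurable_oracle h a wt :
  measurable_fun setT (fun p : 'rV[R]_d * nat => oracle h a wt p.1 p.2).
Proof.
apply/measurable_fun_rVP => b.
rewrite (_ : (fun _ => _) = (fun p : 'rV[R]_d * nat =>
  h b * (p.1 ord0 b - wt b p.2 * a ord0 b))); last first.
  by apply/funext => p; rewrite mxE.
apply: measurable_funM => //; apply: measurable_funB.
  exact: (measurableT_comp (measurable_coord b) measurable_fst).
apply: measurable_funM => //.
have mwt : measurable_fun setT (wt b) by [].
exact: (measurableT_comp mwt measurable_snd).
Qed.

(** The query point cancels, because the noise multiplies only the center: this makes the variance
    bound uniform in [x]. *)
Lemma oracle_error h a wt x xi :
  norm2 (oracle h a wt x xi - grad (quad h a) x) ^+ 2 =
  \sum_b h b ^+ 2 * a ord0 b ^+ 2 * (1 - wt b xi) ^+ 2.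
Proof.
rewrite sqr_norm2; apply: eq_bigr => b _; rewrite grad_quad !mxE.
by ring.
Qed.

(** The oracle is affine in its weight, so a weight of mean 1 gives the exact gradient on
    average. *)
Lemma unbiased_oracle n (h : 'I_n -> 'I_d -> R) a (wt : 'I_n -> 'I_d -> nat -> R)
    N (w : 'I_n -> nat -> R) (w0 : forall i k, 0 <= w i k)
    (w1 : forall i, \sum_(k < N) w i k = 1) :
  (forall i b, \sum_(k < N) w i k * wt i b k = 1) ->
  unbiased (fun i => quad (h i) a)
    (fun i => finite_law (w0 i) (w1 i) : probability nat R)
    (fun i => oracle (h i) a (wt i)).
Proof.
move=> wt1 i x b; split; first exact: integrable_finite_law.
rewrite expectation_finite_law grad_quad mxE; congr EFin.
under eq_bigr do rewrite mxE.
transitivity (h i b * (x ord0 b * (\sum_(k < N) w i k) -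
    (\sum_(k < N) w i k * wt i b k) * a ord0 b)); last by rewrite w1 wt1 mulr1 mul1r.
rewrite mulr_sumr mulr_suml -sumrB mulr_sumr.
by apply: eq_bigr => k _; ring.
Qed.

Lemma expectation_oracle_error h a wt x N (w : nat -> R) (w0 : forall k, 0 <= w k)
    (w1 : \sum_(k < N) w k = 1) :
  ('E_(finite_law w0 w1 : probability nat R)[fun xi =>
    (norm2 (oracle h a wt x xi - grad (quad h a) x) ^+ 2)%R] =
  (\sum_b h b ^+ 2 * a ord0 b ^+ 2 *
    \sum_(k < N) w k * (1 - wt b k) ^+ 2)%R%:E)%E.
Proof.
rewrite expectation_finite_law; congr EFin.
under eq_bigr do rewrite oracle_error mulr_sumr.
rewrite exchange_big/=; apply: eq_bigr => b _.
by rewrite mulr_sumr; apply: eq_bigr => k _; ring.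
Qed.

End oracle.

(** * Executions: time horizon and number of samples read *)

Section run.
Context {R : realType} {n d : nat} (tau : 'I_n -> R).
Variable decision : seq 'rV[R]_d -> 'I_n -> order_to_worker R d.
Implicit Types (s : state R n d) (sample : 'I_n -> nat -> 'rV[R]_d -> 'rV[R]_d).

Let finish := finish_time tau decision.
Let current := current_job decision.

Definition is_next (T : R) s (i : 'I_n) : bool :=
  (finish s i <= T%:E)%E && [forall j, (finish s i <= finish s j)%E].

Lemma next_returnE sample T s : next_return tau decision sample T s =
  if [pick i | is_next T s i] is Some i then
    if current s i is Some (start, x) then
      State (start + tau i)
        (rcons (returned s) (sample i (nreturned s i) x))
        (fun j => if j == i then (nreturned s j).+1 else nreturned s j)
        (fun j => if j == i then None else current s j)
    else s
  else s.
Proof. by []. Qed.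

(** Which return comes first does not depend on the deadline; the deadline only decides whether it
    is performed. Hence a run with an earlier deadline follows the run with deadline [t] and then
    stops. *)
Lemma next_return_le sample (T t : R) s : T <= t ->
  next_return tau decision sample T s = s \/
  next_return tau decision sample T s = next_return tau decision sample t s.
Proof.
move=> Tt; rewrite !next_returnE.
have [/existsP[i /andP[iT /forallP imin]]|/existsPn none] :=
  boolP [exists i, is_next T s i]; last first.
  by left; case: pickP => // i; rewrite (negbTE (none i)).
(* Every worker [j] that finishes first finishes no later than [i], hence by time [T], so both
   deadlines select the same set of workers. *)
right; rewrite (eq_pick (P := is_next T s) (Q := is_next t s)) => [//|j].
rewrite /is_next.
have [/forallP jmin|] := boolP [forall k, (finish s j <= finish s k)%E];
  last by rewrite !andbF.
have jT := le_trans (jmin i) iT.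
by rewrite !andbT jT (le_trans jT)// lee_fin.
Qed.

Lemma iter_next_return_le sample (T t : R) s k : T <= t ->
  exists2 l, (l <= k)%N & iter k (next_return tau decision sample T) s =
                          iter l (next_return tau decision sample t) s.
Proof.
move=> Tt; elim: k => [|k [l lk E]]; first by exists 0.
rewrite iterS E; have [->|->] :=
  next_return_le sample (iter l (next_return tau decision sample t) s) Tt.
  by exists l => //; exact: leqW.
by exists l.+1.
Qed.

(** The information held at any time [T <= t] is a prefix of one single run. This leaves finitely
    many possible outputs up to time [t], although [T] is real. *)
Lemma returned_by_iter sample (T t : R) : (forall i, 0 < tau i) -> T <= t ->
  exists2 l, (l <= \sum_(i < n) Num.truncn (t / tau i))%N &
    returned_by tau decision sample T =
    returned (iter l (next_return tau decision sample t) (initial_state R n d)).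
Proof.
move=> tau0 Tt; rewrite /returned_by.
set k := (\sum_(i < n) Num.truncn (T / tau i))%N.
have [l lk ->] := @iter_next_return_le sample T t (initial_state R n d) k Tt.
exists l => //; apply: leq_trans lk _; apply: leq_sum => i _.
by apply: le_truncn; rewrite ler_pM2r ?invr_gt0.
Qed.

(* This invariant bounds by T / tau i the number of returns of worker i. *)
Definition consistent s := forall i,
  (nreturned s i)%:R * tau i <= clock s /\ forall start x, job s i = Some (start, x) ->
    (nreturned s i)%:R * tau i <= start /\ clock s <= start + tau i.

Lemma consistent_current s i start x : (forall i, 0 < tau i) -> consistent s ->
  current s i = Some (start, x) ->
  (nreturned s i)%:R * tau i <= start /\ clock s <= start + tau i.
Proof.
move=> tau0 /(_ i)[cs js]; rewrite /current /current_job.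
case: decision => [[delay y]|]; last exact: js.
have ti := tau0 i.
have : 0 <= Num.max 0 delay by rewrite le_max lexx.
by move=> ? [<- _]; split; lra.
Qed.

Lemma consistent_next_return sample T s : (forall i, 0 < tau i) ->
  consistent s -> consistent (next_return tau decision sample T s).
Proof.
move=> tau0 cs; rewrite next_returnE.
have [i /andP[_ /forallP imin]|//] := pickP (is_next T s).
case Ei: (current s i) => [[start x]|//] j /=.
have [ci1 ci2] := consistent_current tau0 cs Ei.
have [->|ji] := eqVneq j i.
  by split=> //; rewrite -natr1; lra.
split; first by have [+ _] := cs j; lra.
move=> start' x' Ej; have [cj1 cj2] := consistent_current tau0 cs Ej.
split=> //; have := imin j; rewrite /finish /finish_time -/current Ei Ej.
by rewrite lee_fin.
Qed.

Lemma consistent_initial : consistent (initial_state R n d).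
Proof. by move=> i; split=> //=; rewrite mul0r. Qed.

Lemma consistent_iter sample T k : (forall i, 0 < tau i) ->
  consistent (iter k (next_return tau decision sample T) (initial_state R n d)).
Proof.
move=> tau0; elim: k => [|k IH]; first exact: consistent_initial.
by rewrite iterS; exact: consistent_next_return.
Qed.

(** If worker [i] has already returned [r] gradients, [consistent] makes its next return happen at
    time [(r + 1) * tau i] or later. A return by time [t] thus reads a sample of index below the
    truncation of [t / tau i]. *)
Lemma eq_iter_next_return sample1 sample2 t k : (forall i, 0 < tau i) ->
  (forall i r x, (r < Num.truncn (t / tau i))%N ->
    sample1 i r x = sample2 i r x) ->
  iter k (next_return tau decision sample1 t) (initial_state R n d) =
  iter k (next_return tau decision sample2 t) (initial_state R n d).
Proof.
move=> tau0 E12; elim: k => [//|k IH]; rewrite !iterS -IH.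
set s := iter _ _ _; have cs : consistent s by exact: consistent_iter.
rewrite !next_returnE.
have [i /andP[iT _]|//] := pickP (is_next t s).
case Ei: (current s i) => [[start x]|//].
rewrite E12//; have [ci _] := consistent_current tau0 cs Ei.
move: iT; rewrite /finish /finish_time -/current Ei lee_fin => it.
have ti := tau0 i.
rewrite truncn_gt_nat ler_pdivlMr//.
by rewrite -natr1; lra.
Qed.

End run.

(** * Measurability of total and partial maps glued from countably many pieces *)

Lemma measurable_preimageT d (S : measurableType d) d' (T : measurableType d')
    (f : S -> T) (Y : set T) :
  measurable_fun setT f -> measurable Y -> measurable (f @^-1` Y).
Proof. by move=> mf mY; have := mf measurableT Y mY; rewrite setTI. Qed.

Section gluing.
Context dS (S : measurableType dS).

(** The preimage is the countable union of its traces on the pieces, enumerated through [unpickle].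
    It is stated for a single set [Y] so as to serve total and partial maps alike. *)
Lemma measurable_preimage_glue (I : countType) (T : Type) (E : I -> set S)
    (F : I -> S -> T) (f : S -> T) (Y : set T) :
  (forall i, measurable (E i)) -> (forall u, exists i, E i u) ->
  (forall i u, E i u -> f u = F i u) ->
  (forall i, measurable (F i @^-1` Y)) -> measurable (f @^-1` Y).
Proof.
move=> mE cE fF mF.
rewrite (_ : f @^-1` Y = \bigcup_k
    (if unpickle k is Some i then E i `&` F i @^-1` Y else set0)).
  apply: bigcupT_measurable => k.
  by case: (unpickle k) => [i|]; [exact: measurableI|exact: measurable0].
apply/seteqP; split=> [u Yu|u [k _]].
  have [i Eiu] := cE u; exists (pickle i) => //; rewrite pickleK.
  by split=> //=; rewrite -(fF i u Eiu).
by case: (unpickle k) => //= i [Eiu]; rewrite -(fF i u Eiu).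
Qed.

Lemma measurable_fun_glue (I : countType) d' (T : measurableType d')
    (E : I -> set S) (F : I -> S -> T) (f : S -> T) :
  (forall i, measurable (E i)) -> (forall u, exists i, E i u) ->
  (forall i u, E i u -> f u = F i u) ->
  (forall i, measurable_fun setT (F i)) -> measurable_fun setT f.
Proof.
move=> mE cE fF mF _ Y mY; rewrite setTI.
apply: (measurable_preimage_glue mE cE fF) => i.
by have := mF i measurableT Y mY; rewrite setTI.
Qed.

Lemma measurable_partial_glue (I : countType) d' (T : measurableType d')
    (E : I -> set S) (F : I -> S -> option T) (f : S -> option T) :
  (forall i, measurable (E i)) -> (forall u, exists i, E i u) ->
  (forall i u, E i u -> f u = F i u) ->
  (forall i, measurable_partial (F i)) -> measurable_partial f.
Proof.
move=> mE cE fF mF B mB; apply: (measurable_preimage_glue mE cE fF) => i.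
exact: mF.
Qed.

Lemma measurable_partial_match d' (T : measurableType d') d'' (T' : measurableType d'')
    (c : S -> option T) (phi : T -> T') (v : S -> T') :
  measurable_partial c -> measurable_fun setT phi -> measurable_fun setT v ->
  measurable_fun setT (fun u => if c u is Some p then phi p else v u).
Proof.
move=> mc mphi mv _ Y mY; rewrite setTI.
rewrite (_ : _ @^-1` Y = c @^-1` (Some @` (phi @^-1` Y)) `|`
   (~` (c @^-1` (Some @` setT)) `&` v @^-1` Y)).
  apply: measurableU; first by apply: mc; exact: measurable_preimageT.
  by apply: measurableI; [apply: measurableC; exact: mc|exact: measurable_preimageT].
apply/seteqP; split=> u /=.
  case: (c u) => [p Yp|Yv]; [by left; exists p|right; split=> //].
  by case.
case: (c u) => [p|]; first by case=> [[q Yq [<-]]|[[]]] //; exists p.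
by case=> [[q _]|[]].
Qed.

Lemma measurable_partial_some d' (T : measurableType d') (f : S -> T) :
  measurable_fun setT f -> measurable_partial (fun u => Some (f u)).
Proof.
move=> mf B mB; rewrite (_ : _ @^-1` _ = f @^-1` B).
  exact: measurable_preimageT.
by apply/seteqP; split=> u /=; [case=> x Bx [<-]|exists (f u)].
Qed.

Lemma measurable_partial_none d' (T : measurableType d') :
  measurable_partial (fun _ : S => None : option T).
Proof.
by move=> B mB; rewrite (_ : _ @^-1` _ = set0)//; apply/seteqP; split=> u // -[].
Qed.

Lemma measurable_partial_isSome d' (T : measurableType d') (c : S -> option T) :
  measurable_partial c -> measurable_fun setT (fun u => isSome (c u)).
Proof.
move=> mc; apply: (measurable_fun_bool true); rewrite setTI.
rewrite (_ : _ @^-1` _ = c @^-1` (Some @` setT)); first exact: mc.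
apply/seteqP; split=> u /=; last by case=> x _ <-.
by case: (c u) => // x _; exists x.
Qed.

Lemma measurable_partial_if d' (T : measurableType d') (b : S -> bool)
    (c1 c2 : S -> option T) : measurable_fun setT b ->
  measurable_partial c1 -> measurable_partial c2 ->
  measurable_partial (fun u => if b u then c1 u else c2 u).
Proof.
move=> mb m1 m2.
apply: (@measurable_partial_glue _ _ _ (fun x => b @^-1` [set x])
  (fun x => if x then c1 else c2)).
- by move=> x; exact: measurable_preimageT.
- by move=> u; exists (b u).
- by move=> x u <-; case: (b u).
- by case.
Qed.

Lemma measurable_fun_comp_nat (f : S -> nat) d' (T : measurableType d') (phi : nat -> T) :
  measurable_fun setT f -> measurable_fun setT (fun u => phi (f u)).
Proof.
move=> mf; have mphi : measurable_fun setT phi by [].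
exact: (measurableT_comp mphi mf).
Qed.

End gluing.

(** * Measurability of a run in the internal randomness *)

Section measurable_run.
Context dS (S : measurableType dS) {R : realType} {n d : nat}.
Local Notation V := 'rV[R]_d.

(** A list of random length is described by its length and its entries padded with 0; on each event
    of fixed length it is a tuple. *)
Definition measurable_seq (r : S -> seq V) :=
  measurable_fun setT (fun u => size (r u)) /\
  forall j, measurable_fun setT (fun u => nth 0 (r u) j).

Lemma measurable_seq_tuple (r : S -> seq V) k : measurable_seq r ->
  measurable_fun setT (fun u => [tuple nth 0 (r u) j | j < k]).
Proof.
move=> [_ mr]; apply/measurable_fun_tnthP => j.
rewrite (_ : _ \o _ = fun u => nth 0 (r u) j)//.
by apply/funext => u /=; rewrite tnth_mktuple.
Qed.

Lemma measurable_seq_preimage (T : Type) (F : S -> seq V -> T) (r : S -> seq V)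
    (Y : set T) : measurable_seq r ->
  (forall k, measurable ((fun p : S * k.-tuple V => F p.1 p.2) @^-1` Y)) ->
  measurable ((fun u => F u (r u)) @^-1` Y).
Proof.
move=> mr mF; have [ms _] := mr.
apply: (@measurable_preimage_glue _ _ nat _ (fun k => (fun u => size (r u)) @^-1` [set k])
  (fun k u => F u [tuple nth 0 (r u) j | j < k])).
- by move=> k; exact: measurable_preimageT.
- by move=> u; exists (size (r u)).
- move=> k u /= <-; congr (F u _); apply: (@eq_from_nth _ 0).
    by rewrite size_map size_enum_ord.
  move=> i ir; rewrite (nth_map (Ordinal ir)) ?size_enum_ord//.
  by rewrite nth_enum_ord.
- move=> k.
  have mp : measurable_fun setT (fun u => (u, [tuple nth 0 (r u) j | j < k])).
    by apply: measurable_fun_pair => //; exact: measurable_seq_tuple.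
  exact: (measurable_preimageT mp (mF k)).
Qed.

Lemma measurable_seq_rcons (r : S -> seq V) (v : S -> V) :
  measurable_seq r -> measurable_fun setT v ->
  measurable_seq (fun u => rcons (r u) (v u)).
Proof.
move=> [ms mr] mv; split=> [|j].
  under eq_fun do rewrite size_rcons.
  exact: (measurable_fun_comp_nat succn ms).
under eq_fun do rewrite nth_rcons.
apply: measurable_fun_ifT => //.
  exact: (measurable_fun_comp_nat (fun k => (j < k)%N) ms).
apply: measurable_fun_ifT => //.
exact: (measurable_fun_comp_nat (fun k => j == k) ms).
Qed.

Definition measurable_state (s : S -> state R n d) :=
  [/\ measurable_fun setT (fun u => clock (s u)),
    measurable_seq (fun u => returned (s u)),
    forall i, measurable_fun setT (fun u => nreturned (s u) i) &
    forall i, measurable_partial (fun u => job (s u) i)].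

Lemma measurable_state_glue (I : countType) (E : I -> set S)
    (F : I -> S -> state R n d) (f : S -> state R n d) :
  (forall i, measurable (E i)) -> (forall u, exists i, E i u) ->
  (forall i u, E i u -> f u = F i u) ->
  (forall i, measurable_state (F i)) -> measurable_state f.
Proof.
move=> mE cE fF mF; split.
- apply: (measurable_fun_glue mE cE) => [i u /fF -> //|i].
  by case: (mF i).
- split=> [|j]; apply: (measurable_fun_glue mE cE) => [i u /fF -> //|i].
    by case: (mF i) => _ [].
  by case: (mF i) => _ [].
- move=> j; apply: (measurable_fun_glue mE cE) => [i u /fF -> //|i].
  by case: (mF i).
- move=> j; apply: (measurable_partial_glue mE cE) => [i u /fF -> //|i].
  by case: (mF i).
Qed.

Variables (tau : 'I_n -> R).
Variable decision : S -> seq V -> 'I_n -> order_to_worker R d.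
Hypothesis mdecision : forall k i,
  measurable_partial (fun p : S * k.-tuple V => decision p.1 p.2 i).
Variable sample : 'I_n -> nat -> V -> V.
Hypothesis msample : forall i r, measurable_fun setT (sample i r).

Lemma measurable_current_job s i : measurable_state s ->
  measurable_partial (fun u => current_job (decision u) (s u) i).
Proof.
move=> [mc mr _ mj]; rewrite /current_job.
have md : measurable_partial (fun u => decision u (returned (s u)) i).
  move=> B mB.
  apply: (@measurable_seq_preimage _ (fun u r => decision u r i)) => // k.
  exact: mdecision.
(* The two components of an order are extracted separately. The values 0 are placeholders: they
   occur only when there is no order, a case discarded by the outer test. *)
rewrite (_ : (fun u => _) = (fun u => if isSome (decision u (returned (s u)) i)
   then Some (clock (s u) + Num.max 0
     (if decision u (returned (s u)) i is Some p then p.1 else 0),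
     (if decision u (returned (s u)) i is Some p then p.2 else 0))
   else job (s u) i)); last first.
  by apply/funext => u; case: decision => [[]|].
apply: measurable_partial_if; [exact: measurable_partial_isSome| |exact: mj].
apply: measurable_partial_some; apply: measurable_fun_pair.
  apply: measurable_funD => //; apply: measurable_maxr => //.
  exact: measurable_partial_match.
exact: measurable_partial_match.
Qed.

Lemma measurable_finish_time s i : measurable_state s ->
  measurable_fun setT (fun u => finish_time tau (decision u) (s u) i).
Proof.
move=> ms; rewrite /finish_time.
rewrite (_ : (fun u => _) = (fun u => if current_job (decision u) (s u) i
  is Some p then (p.1 + tau i)%:E else +oo%E)); last first.
  by apply/funext => u; case: current_job => [[]|].
apply: measurable_partial_match => //; first exact: measurable_current_job.
apply/measurable_EFinP; exact: measurable_funD.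
Qed.

Lemma measurable_is_next T s i : measurable_state s ->
  measurable_fun setT (fun u => is_next tau (decision u) T (s u) i).
Proof.
move=> ms; apply: measurable_and.
  by apply: measurable_fun_lee => //; exact: measurable_finish_time.
apply: (measurable_fun_bool true); rewrite setTI.
rewrite (_ : _ @^-1` _ = \big[setI/setT]_(j < n) ((fun u =>
    (finish_time tau (decision u) (s u) i <= finish_time tau (decision u) (s u) j)%E)
    @^-1` [set true])).
  apply: bigsetI_measurable => j _; apply: measurable_preimageT => //.
  by apply: measurable_fun_lee; exact: measurable_finish_time.
apply/seteqP; split=> u; rewrite -bigcap_seq /=.
  by move=> /forallP H j _; exact: H.
by move=> H; apply/forallP => j; exact: (H j (mem_index_enum j)).
Qed.

(** The state space is cut according to the set of workers that may return next. There are finitely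
    many such sets, and on each piece the worker selected by [pick] is constant. *)
Lemma measurable_next_return T s : measurable_state s ->
  measurable_state (fun u => next_return tau (decision u) sample T (s u)).
Proof.
move=> ms.
pose p u := [set i | is_next tau (decision u) T (s u) i]%SET.
apply: (@measurable_state_glue {set 'I_n} (fun A => p @^-1` [set A])
 (fun A u => if [pick i in A] is Some i then
   State ((if current_job (decision u) (s u) i is Some q then q.1 else 0) + tau i)
     (rcons (returned (s u)) (sample i (nreturned (s u) i)
        (if current_job (decision u) (s u) i is Some q then q.2 else 0)))
     (fun j => if j == i then (nreturned (s u) j).+1 else nreturned (s u) j)
     (fun j => if j == i then None else current_job (decision u) (s u) j)
   else s u)).
- move=> A.
  rewrite (_ : _ @^-1` _ = \big[setI/setT]_(i < n)
    ((fun u => is_next tau (decision u) T (s u) i) @^-1` [set i \in A])).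
    apply: bigsetI_measurable => i _.
    by apply: measurable_preimageT => //; exact: measurable_is_next.
  apply/seteqP; split=> u /=.
    by move=> <-; rewrite -bigcap_seq => i _ /=; rewrite inE.
  rewrite -bigcap_seq => H; apply/setP => i; rewrite inE.
  exact: (H i (mem_index_enum i)).
- by move=> u; exists (p u).
- move=> A u /= <-; rewrite next_returnE.
  rewrite -(eq_pick (P := is_next tau (decision u) T (s u)) (Q := mem (p u)));
    last by move=> i; rewrite /= inE.
  case: pickP => // i /andP[+ _]; rewrite /finish_time.
  by case: current_job => [[start x]|].
- move=> A; case: pickP => [i _|//].
  have [mc mr mn mj] := ms.
  have mi := measurable_current_job i ms.
  split=> /=.
  + by apply: measurable_funD => //; exact: measurable_partial_match.
  + apply: measurable_seq_rcons => //.
    (* The index of the sample is itself random, hence a second gluing over its values. *)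
    apply: (@measurable_fun_glue _ _ nat _ _
      (fun k => (fun u => nreturned (s u) i) @^-1` [set k])
      (fun k u => sample i k
        (if current_job (decision u) (s u) i is Some q then q.2 else 0))).
    * by move=> k; exact: measurable_preimageT.
    * by move=> u; exists (nreturned (s u) i).
    * by move=> k u /= ->.
    * move=> k; apply: (measurableT_comp (msample i k)).
      exact: measurable_partial_match.
  + move=> j; case: eqP => // _; exact: (measurable_fun_comp_nat succn (mn j)).
  + move=> j; case: eqP => _; first exact: measurable_partial_none.
    exact: measurable_current_job.
Qed.

Lemma measurable_initial : measurable_state (fun=> initial_state R n d).
Proof.
split=> //=; last by move=> i; exact: measurable_partial_none.
Qed.

Lemma measurable_iter_next_return T k : measurable_state (fun u =>
  iter k (next_return tau (decision u) sample T) (initial_state R n d)).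
Proof.
elim: k => [|k IH]; first exact: measurable_initial.
exact: measurable_next_return IH.
Qed.

End measurable_run.

(** * Block coordinates and the unknown minimizer *)

Section needle.
Context {R : realType} {n D : nat} (Delta : 'I_n -> R).

Definition ncoord := #|{: 'I_n * 'I_D}|.

Definition block (b : 'I_ncoord) : 'I_n := (enum_val b).1.

Definition needle (kappa : {ffun 'I_n -> 'I_D}) : 'rV[R]_ncoord :=
  \row_b (Delta (block b) * ((enum_val b).2 == kappa (block b))%:R).

Definition block_dist2 (v : 'rV[R]_ncoord) (j : 'I_n) (k : 'I_D) : R :=
  \sum_(p < D) (v ord0 (enum_rank (j, p)) - Delta j * (p == k)%:R) ^+ 2.

Lemma sum_coords (F : 'I_ncoord -> R) :
  \sum_b F b = \sum_(j < n) \sum_(p < D) F (enum_rank (j, p)).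
Proof.
rewrite pair_bigA (reindex (@enum_val _ {: 'I_n * 'I_D})) /=; last first.
  exact/onW_bij/enum_val_bij.
by apply: eq_bigr => b _; rewrite -surjective_pairing enum_valK.
Qed.

Lemma sqr_norm2_needle v kappa :
  norm2 (v - needle kappa) ^+ 2 = \sum_j block_dist2 v j (kappa j).
Proof.
rewrite sqr_norm2 sum_coords; apply: eq_bigr => j _; apply: eq_bigr => p _.
by rewrite !mxE /block enum_rankK.
Qed.

Lemma block_dist2_ge0 v j k : 0 <= block_dist2 v j k.
Proof. by apply: sumr_ge0 => p _; exact: sqr_ge0. Qed.

(** Two candidate blocks are at squared distance [2 * Delta j ^+ 2], and the sum of the squared
    distances of a point to both is least at their midpoint. So at most one of them is within
    squared distance [Delta j ^+ 2 / 2]. *)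
Lemma block_dist2_far v j k k' : k != k' ->
  Delta j ^+ 2 <= block_dist2 v j k + block_dist2 v j k'.
Proof.
move=> kk'; rewrite /block_dist2 -big_split/=.
have k'k : k' != k by rewrite eq_sym.
rewrite (bigD1 k)//= (bigD1 k')//= !eqxx (negbTE kk') (negbTE k'k).
rewrite !mulr1 !mulr0 !subr0.
set x := v _ _; set y := v _ _; set z := \sum_(i | _) _.
have : 0 <= z by apply: sumr_ge0 => p _; rewrite addr_ge0 ?sqr_ge0.
have := sqr_ge0 (2 * x - Delta j); have := sqr_ge0 (2 * y - Delta j).
by nra.
Qed.

Lemma sum_needle (c : 'I_n -> R) kappa :
  \sum_b c (block b) * needle kappa ord0 b ^+ 2 = \sum_j c j * Delta j ^+ 2.
Proof.
rewrite sum_coords; apply: eq_bigr => j _.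
rewrite (bigD1 (kappa j))//= big1 => [|p pk].
  by rewrite mxE /block enum_rankK /= eqxx mulr1 addr0.
by rewrite mxE /block enum_rankK /= (negbTE pk) mulr0 expr0n mulr0.
Qed.

Lemma measurable_block_dist2 j k :
  measurable_fun setT (fun v : 'rV[R]_ncoord => block_dist2 v j k).
Proof.
apply: measurable_sum => p; apply: measurable_funX; apply: measurable_funB => //.
exact: measurable_coord.
Qed.

End needle.

(** * Law of the noise *)

Section weights.
Context {R : realType} (p delta : R).

(* The outcome 0 shows nothing, 1 shows the block of the worker itself and 2
   shows all the blocks. *)
Definition reveal_prob : R := p + delta - p * delta.

Definition reveal_weight (k : nat) : R :=
  match k with
  | 0 => (1 - p) * (1 - delta)
  | 1 => p * (1 - delta)
  | _ => delta
  end.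

Hypothesis p01 : 0 <= p <= 1.
Hypothesis d01 : 0 < delta < 1.

Lemma reveal_weight_ge0 k : 0 <= reveal_weight k.
Proof.
case/andP: p01 => p0 p1; case/andP: d01 => /ltW d0 /ltW d1.
by case: k => [|[|k]] //=; rewrite mulr_ge0 ?subr_ge0.
Qed.

Lemma sum_reveal_weight : \sum_(k < 3) reveal_weight k = 1.
Proof. by rewrite !big_ord_recl big_ord0 /=; ring. Qed.

Lemma reveal_prob_gt0 : 0 < reveal_prob.
Proof.
case/andP: p01 => p0 _; case/andP: d01 => d0 d1.
have : 0 <= p * (1 - delta) by rewrite mulr_ge0// subr_ge0 ltW.
by rewrite /reveal_prob; lra.
Qed.

(** [reveal_prob] is [1 - (1 - p) * (1 - delta)], the probability of a nonzero outcome, so dividing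
    the indicator by it gives mean 1. *)
Lemma sum_reveal_own : \sum_(k < 3) reveal_weight k * ((0 < k)%N%:R / reveal_prob) = 1.
Proof.
rewrite !big_ord_recl big_ord0 /= /reveal_weight /=.
have := reveal_prob_gt0; rewrite /reveal_prob => P0.
by field; rewrite gt_eqF.
Qed.

Lemma sum_reveal_other : \sum_(k < 3) reveal_weight k * ((1 < k)%N%:R / delta) = 1.
Proof.
rewrite !big_ord_recl big_ord0 /= /reveal_weight /=.
by field; case/andP: d01 => d0 _; rewrite gt_eqF.
Qed.

Lemma var_reveal_own :
  \sum_(k < 3) reveal_weight k * (1 - (0 < k)%N%:R / reveal_prob) ^+ 2 =
  reveal_prob^-1 - 1.
Proof.
rewrite !big_ord_recl big_ord0 /= /reveal_weight /=.
have := reveal_prob_gt0; rewrite /reveal_prob => P0.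
by field; rewrite gt_eqF.
Qed.

Lemma var_reveal_other :
  \sum_(k < 3) reveal_weight k * (1 - (1 < k)%N%:R / delta) ^+ 2 = delta^-1 - 1.
Proof.
rewrite !big_ord_recl big_ord0 /= /reveal_weight /=.
by field; case/andP: d01 => d0 _; rewrite gt_eqF.
Qed.

End weights.

(** * Inequalities for products, integrals and probabilities *)

Lemma ge1B_prod (R : realDomainType) (I : finType) (s : I -> R) :
  (forall i, 0 <= s i <= 1) -> 1 - \sum_i (1 - s i) <= \prod_i s i.
Proof.
(* The upper bound 1 on the partial product is carried along, as the inductive step multiplies
   [1 - y >= 0] by [s i <= 1]. *)
move=> s01; suff : \prod_i s i <= 1 /\ 1 - \sum_i (1 - s i) <= \prod_i s i by case.
apply: (big_rec2 (fun x y : R => y <= 1 /\ 1 - x <= y)); first by rewrite subr0.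
move=> i x y _ [y1 xy]; have /andP[s0 s1] := s01 i; split.
  by rewrite (le_trans (ler_wpM2l s0 y1))// mulr1.
nra.
Qed.

Section integral_bounds.
Local Open Scope ereal_scope.
Context d (T : measurableType d) (R : realType).
Variable mu : {measure set T -> \bar R}.

(* No measurability is required: the integral of a nonnegative function is the
   supremum of the integrals of the simple functions below it. *)
Lemma ge0_le_integral_nonmeas (f1 f2 : T -> \bar R) :
  (forall x, 0 <= f1 x) -> (forall x, f1 x <= f2 x) ->
  \int[mu]_x f1 x <= \int[mu]_x f2 x.
Proof.
move=> f10 f12; have f20 x : 0 <= f2 x by exact: le_trans (f12 x).
rewrite !ge0_integralTE//; apply: le_ereal_sup => _ [h hf <-].
by exists h => // x; exact: le_trans (f12 x).
Qed.

Lemma integral_sum_indic (I : finType) (alpha : I -> R) (E : I -> set T) :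
  (forall i, 0 <= alpha i)%R -> (forall i, measurable (E i)) ->
  \int[mu]_x (\sum_i alpha i * \1_(E i) x)%R%:E = \sum_i (alpha i)%:E * mu (E i).
Proof.
move=> a0 mE; under eq_integral do rewrite -sumEFin.
rewrite ge0_integral_sum//=.
- apply: eq_bigr => i _; under eq_integral do rewrite EFinM.
  rewrite ge0_integralZl_EFin//=.
  + by rewrite integral_indic// setIT.
  + exact/measurable_EFinP/measurable_indic.
- by move=> i; apply/measurable_EFinP; apply: measurable_funM.
- by move=> i x _; rewrite lee_fin mulr_ge0.
Qed.

Lemma le_expectation_indic (I : finType) (alpha : I -> R) (E : I -> set T) (f : T -> R) :
  (forall i, 0 <= alpha i)%R -> (forall i, measurable (E i)) ->
  (forall x, \sum_i alpha i * \1_(E i) x <= f x)%R ->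
  \sum_i (alpha i)%:E * mu (E i) <= \int[mu]_x (f x)%:E.
Proof.
move=> a0 mE Ef; rewrite -integral_sum_indic//.
apply: ge0_le_integral_nonmeas => x; rewrite lee_fin//.
by apply: sumr_ge0 => i _; rewrite mulr_ge0.
Qed.

End integral_bounds.

Section probability_bounds.
Context d (T : measurableType d) (R : realType) (P : probability T R).

Lemma fine_probability (A : set T) : measurable A -> ((fine (P A))%:E = P A)%E.
Proof. by move=> mA; rewrite fineK// fin_num_measure. Qed.

(** The indicators of disjoint events add up to at most 1 at every point, and this is integrated. *)
Lemma sum_probability_disjoint (I : finType) (E : I -> set T) :
  (forall i, measurable (E i)) ->
  (forall i j x, E i x -> E j x -> i = j) -> \sum_i fine (P (E i)) <= 1.
Proof.
move=> mE dE; rewrite -lee_fin -sumEFin.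
have <- : (\int[P]_x (1%R)%:E = 1)%E.
  by rewrite integral_cst// mul1e; exact: probability_setT.
rewrite (eq_bigr (fun i => (1%R)%:E * P (E i))%E) => [|i _]; last first.
  by rewrite mul1e fine_probability.
apply: le_expectation_indic => // x.
have [/existsP[i /asboolP Ei]|/existsPn none] := boolP [exists i, `[< E i x >]].
  rewrite (bigD1 i)//= big1 => [|j ji]; first by rewrite addr0 mul1r indicE mem_set.
  rewrite indicE memNset ?mulr0// => Ej; move/eqP: ji; apply; exact: dE Ej Ei.
rewrite big1// => i _; rewrite indicE memNset ?mulr0// => Ei.
by move: (none i); rewrite asboolT.
Qed.

Lemma union_bound (I : finType) (H : I -> set T) (G : set T) :
  (forall i, measurable (H i)) -> measurable G ->
  (forall x, ~ G x -> exists i, H i x) -> 1 - \sum_i fine (P (H i)) <= fine (P G).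
Proof.
move=> mH mG GH; pose U := \big[setU/set0]_i H i.
have mU : measurable U by apply: bigsetU_measurable.
have PU : (P U <= \sum_i P (H i))%E.
  rewrite /U; elim: (index_enum I) => [|i s IH].
    by rewrite !big_nil measure0.
  have mUs : measurable (\big[setU/set0]_(j <- s) H j).
    by apply: bigsetU_measurable.
  by rewrite !big_cons (le_trans (measureU2 _ (mH i) mUs))// leeD.
rewrite lerBlDr -lee_fin EFinD -sumEFin fine_probability//.
under eq_bigr do rewrite fine_probability//.
rewrite (le_trans _ (leeD (lexx _) PU))// -(probability_setT P).
rewrite (le_trans _ (measureU2 _ mG mU))//.
apply: le_measure; rewrite ?inE//; first exact: measurableU.
move=> x _; have [Gx|/GH[i Hi]] := pselect (G x); [by left|right].
by rewrite /U -bigcup_seq; exists i => //=; exact: mem_index_enum.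
Qed.

End probability_bounds.

(** * Averaging over the unknown vector *)

Section averaging.
Context {R : realFieldType} {n D : nat}.
Implicit Types kappa : {ffun 'I_n -> 'I_D}.

Definition update kappa (j : 'I_n) (k : 'I_D) : {ffun 'I_n -> 'I_D} :=
  [ffun i => if i == j then k else kappa i].

(* (kappa, k) |-> (update kappa j k, kappa j) is an involution. *)
Lemma sum_update (F : {ffun 'I_n -> 'I_D} -> R) (j : 'I_n) :
  \sum_kappa \sum_k F (update kappa j k) = D%:R * \sum_kappa F kappa.
Proof.
pose phi (p : {ffun 'I_n -> 'I_D} * 'I_D) := (update p.1 j p.2, p.1 j).
have phiK : involutive phi.
  move=> [kappa k]; rewrite /phi /= ffunE eqxx; congr (_, _).
  by apply/ffunP => i; rewrite !ffunE; case: eqP => [->|].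
rewrite pair_bigA (reindex_inj (inv_inj phiK))/=.
rewrite -(pair_bigA _ (fun kappa k => F (update (update kappa j k) j (kappa j))))/=.
rewrite mulr_sumr; apply: eq_bigr => kappa _.
rewrite (eq_bigr (fun=> F kappa)) => [|k _].
  by rewrite sumr_const card_ord mulr_natl.
congr F; apply/ffunP => i; rewrite !ffunE.
by case: eqP => [->|].
Qed.

(** Here [c] stands for the outcomes of the samples, [W c] for their probability, [good j c] for
    block [j] being hidden, [l] for a candidate output and [q] for its probability of being close to
    the truth in block [j]. While block [j] is hidden, resampling [kappa j] makes [q] at most
    [1 / D] on average, so all candidates together lose at most [#|L| / D]. Some [kappa] is at least
    as good as the average. *)
Lemma exists_above_average (C L : finType) (alpha : 'I_n -> R) (W : C -> R)
    (good : 'I_n -> pred C) (q : {ffun 'I_n -> 'I_D} -> C -> L -> 'I_n -> R) (beta : R) :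
  (0 < D)%N -> (#|L| <= D)%N -> (forall j, 0 <= alpha j) -> (forall c, 0 <= W c) ->
  (forall j, beta <= \sum_(c | good j c) W c) ->
  (forall j c l kappa, good j c -> \sum_k q (update kappa j k) c l j <= 1) ->
  exists kappa, (\sum_j alpha j) * beta * (1 - #|L|%:R / D%:R) <=
    \sum_j alpha j * \sum_(c | good j c) W c * (1 - \sum_l q kappa c l j).
Proof.
move=> D0 LD a0 W0 Wb q1.
have D0' : 0 < D%:R :> R by rewrite ltr0n.
set B := _ * _ * _; pose S kappa := \sum_j alpha j *
  \sum_(c | good j c) W c * (1 - \sum_l q kappa c l j).
apply: contrapT => /forallNP noS.
pose T : R := #|{: {ffun 'I_n -> 'I_D}}|%:R.
have T0 : 0 < T.
  rewrite ltr0n card_ffun card_ord expn_gt0.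
  by rewrite D0.
have avgq j c l : good j c -> \sum_kappa q kappa c l j <= T / D%:R.
  move=> gc; rewrite ler_pdivlMr// mulrC -(sum_update (fun kappa => q kappa c l j) j).
  rewrite /T -sum1_card natr_sum; apply: ler_sum => kappa _; exact: q1.
have : \sum_kappa S kappa < T * B.
  rewrite /T -sum1_card natr_sum mulr_suml.
  apply: ltr_sum => [|kappa _].
    (* Strictness of the sum requires one index, and [0 < D] provides a constant [kappa]. *)
    apply/hasP; exists [ffun=> Ordinal D0]; rewrite ?mem_index_enum//.
  by rewrite mul1r ltNge; apply/negP/noS.
apply/negP; rewrite -leNgt.
rewrite /S exchange_big/= /B -mulrA mulr_suml mulr_sumr; apply: ler_sum => j _.
rewrite -mulr_sumr mulrCA ler_wpM2l// exchange_big/=.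
have L1 : 0 <= 1 - #|L|%:R / D%:R :> R.
  by rewrite subr_ge0 ler_pdivrMr// mul1r ler_nat.
rewrite mulrA (le_trans (y := \sum_(c | good j c) W c * (T * (1 - #|L|%:R / D%:R))))//.
  rewrite -mulr_suml -mulrA [X in X <= _]mulrCA ler_wpM2r//.
  by rewrite mulr_ge0// ltW.
apply: ler_sum => c gc; rewrite -mulr_sumr ler_wpM2l// sumrB.
rewrite exchange_big/= sumr_const mulrBr mulr1 lerB//.
rewrite mulrCA (le_trans (ler_sum _ (fun l _ => avgq j c l gc)))//.
by rewrite sumr_const -(mulr_natl (T / D%:R)).
Qed.

End averaging.

(** * The hard functions and their stochastic gradients *)

Section hard_instance.
Context {R : realType} {n D : nat} (Delta p : 'I_n -> R) (delta A : R).
Hypothesis p01 : forall i, 0 <= p i <= 1.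
Hypothesis delta01 : 0 < delta < 1.
Hypothesis deltaA : delta <= A.
Implicit Types kappa : {ffun 'I_n -> 'I_D}.

Definition hess (i : 'I_n) (b : 'I_(@ncoord n D)) : R :=
  if block b == i then A else delta.

Definition rescale (i : 'I_n) (b : 'I_(@ncoord n D)) (xi : nat) : R :=
  if block b == i then (0 < xi)%N%:R / reveal_prob (p i) delta
  else (1 < xi)%N%:R / delta.

Definition loss kappa i := quad (hess i) (needle Delta kappa).

Definition sgrad kappa i := oracle (hess i) (needle Delta kappa) (rescale i).

Definition noise (i : 'I_n) : probability nat R :=
  finite_law (reveal_weight_ge0 (p01 i) delta01) (sum_reveal_weight (p i) delta).

Lemma hess_gt0 i b : 0 < hess i b.
Proof.
case/andP: delta01 => d0 _; rewrite /hess; case: ifP => // _.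
exact: lt_le_trans deltaA.
Qed.

Lemma hess_le i b : hess i b <= A.
Proof. by rewrite /hess; case: ifP. Qed.

Definition avg_hess : R := n%:R^-1 * (A - delta) + delta.

(** Each block belongs to exactly one worker, so the averaged curvature is the same in all
    coordinates. *)
Lemma average_loss kappa : (0 < n)%N ->
  average (loss kappa) = quad (fun=> avg_hess) (needle Delta kappa).
Proof.
move=> n0; have n0' : n%:R != 0 :> R by rewrite pnatr_eq0 -lt0n.
apply/funext => x; rewrite /average /loss /quad exchange_big/= mulr_sumr.
apply: eq_bigr => b _; rewrite -mulr_suml mulrA; congr (_ * _).
rewrite -mulr_suml mulrA; congr (_ / _).
rewrite (eq_bigr (fun i => (if i == block b then A - delta else 0) + delta)).
  rewrite big_split/= -big_mkcond big_pred1_eq sumr_const card_ord mulrDr.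
  by rewrite -[delta *+ n]mulr_natl mulrA mulVf// mul1r.
by move=> i _; rewrite /hess eq_sym; case: ifP; rewrite ?subrK ?add0r.
Qed.

Lemma unbiased_sgrad kappa : unbiased (loss kappa) noise (sgrad kappa).
Proof.
apply: unbiased_oracle => i b; rewrite /rescale; case: (block b == i).
  exact: sum_reveal_own.
exact: sum_reveal_other.
Qed.

(** Half of the budget goes to the block of the worker itself. Each other block [j] costs
    [(delta - delta ^+ 2) * Delta j ^+ 2], since its squared curvature [delta ^+ 2] outweighs the
    variance of order [delta^-1]. *)
Lemma variance_bounded_sgrad kappa (sigma2 : R) :
  (forall i, A ^+ 2 * ((reveal_prob (p i) delta)^-1 - 1) * Delta i ^+ 2 <= sigma2 / 2) ->
  delta * \sum_i Delta i ^+ 2 <= sigma2 / 2 ->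
  variance_bounded (loss kappa) noise (sgrad kappa) sigma2.
Proof.
move=> own other i x; case/andP: delta01 => d0 d1.
rewrite expectation_oracle_error lee_fin.
pose c j := if j == i then A ^+ 2 * ((reveal_prob (p i) delta)^-1 - 1)
            else delta ^+ 2 * (delta^-1 - 1).
rewrite (eq_bigr (fun b => c (block b) * needle Delta kappa ord0 b ^+ 2)) => [|b _].
  rewrite (sum_needle Delta c) (bigD1 i)//= {1}/c eqxx.
  have -> : sigma2 = sigma2 / 2 + sigma2 / 2 by field.
  apply: lerD; first exact: own.
  apply: le_trans other; rewrite mulr_sumr [leRHS](bigD1 i)//=.
  rewrite -[leLHS]add0r; apply: lerD; first by rewrite mulr_ge0 ?sqr_ge0// ltW.
  apply: ler_sum => j ji; rewrite /c (negbTE ji) ler_wpM2r ?sqr_ge0//.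
  have -> : delta ^+ 2 * (delta^-1 - 1) = delta - delta ^+ 2.
    by field; rewrite gt_eqF.
  by rewrite lerBlDr lerDl sqr_ge0.
rewrite mulrAC; congr (_ * _); rewrite /c /hess /rescale; case: (block b == i).
  by rewrite var_reveal_own.
by rewrite var_reveal_other.
Qed.

Lemma noise_set1 i (x : 'I_3) : noise i [set val x] = (reveal_weight (p i) delta x)%:E.
Proof.
rewrite /noise/= finite_lawE; congr EFin.
rewrite (bigD1 x)//= big1 => [|k kx].
  by rewrite addr0 indicE mem_set// mulr1.
by rewrite indicE memNset ?mulr0// => /= /val_inj/eqP; exact/negP.
Qed.

End hard_instance.

(** * Lower bound for a given method *)

Section lower_bound.
Context {R : realType} {n D m : nat} (Delta p : 'I_n -> R) (delta A : R).
Hypothesis p01 : forall i, 0 <= p i <= 1.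
Hypothesis delta01 : 0 < delta < 1.
Variables (tau : 'I_n -> R) (t : R) (M : randomized_method R n m (@ncoord n D)).
Hypothesis tau_gt0 : forall i, 0 < tau i.
Implicit Types kappa : {ffun 'I_n -> 'I_D}.

Definition max_returns (i : 'I_n) : nat := Num.truncn (t / tau i).

Definition total_returns : nat := (\sum_(i < n) max_returns i)%N.

Local Notation config := {ffun 'I_n * 'I_total_returns.+1 -> 'I_3}.
(** An output up to time [t] is determined by its index and by the number of returns performed,
    which ranges from 0 to [total_returns] included. *)
Local Notation candidate := ('I_m * 'I_total_returns.+1)%type.

(* The samples used by time t do not show block j. *)
Definition hidden (j : 'I_n) (c : config) : bool :=
  c \in family (fun ik : 'I_n * 'I_total_returns.+1 => [pred x : 'I_3 |
    (ik.2 < max_returns ik.1)%N ==> (x < if ik.1 == j then 1 else 2)%N]).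

Definition config_weight (c : config) : R :=
  \prod_ik reveal_weight (p ik.1) delta (c ik).

(** [inord] is faithful on the indices below [max_returns i], the only ones that a run up to time
    [t] reads. *)
Definition config_sample kappa (c : config) i r x :=
  sgrad Delta p delta A kappa i x (c (i, inord r)).

Definition config_run kappa c (u : seed M) l : state R n (@ncoord n D) :=
  iter l (next_return tau (decide u 0) (config_sample kappa c) t)
    (initial_state R n (@ncoord n D)).

Definition config_output kappa c (l : candidate) (u : seed M) : 'rV[R]_(@ncoord n D) :=
  output l.1 u 0 (returned (config_run kappa c u l.2)).

Definition hit kappa c (l : candidate) (j : 'I_n) : set (seed M) :=
  [set u | block_dist2 Delta (config_output kappa c l u) j (kappa j) < Delta j ^+ 2 / 2].

Lemma max_returns_lt i r : (r < max_returns i)%N -> (r < total_returns.+1)%N.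
Proof.
move=> ri; rewrite ltnS (leq_trans (ltnW ri))// /total_returns.
by rewrite (bigD1 i)//= leq_addr.
Qed.

(** For a hidden block [j], every sample that is read has weight 0 there: worker [j] only draws 0,
    the other workers only 0 or 1. The value [kappa j] is multiplied by this weight and never enters
    the run. *)
Lemma config_run_update kappa c u l j k : hidden j c ->
  config_run (update kappa j k) c u l = config_run kappa c u l.
Proof.
move=> /familyP hc; apply: eq_iter_next_return => // i r x ri.
have rN := max_returns_lt ri.
apply/rowP => b; rewrite !mxE ffunE; case: (block b =P j) => [bj|//].
have := hc (i, inord r); rewrite inE /= inordK// ri /= /rescale bj [j == i]eq_sym.
by case: (i == j); case: (val (c (i, inord r))) => [|[|]]//; rewrite !mul0r !subr0.
Qed.

Lemma config_output_update kappa c l u j k : hidden j c ->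
  config_output (update kappa j k) c l u = config_output kappa c l u.
Proof. by move=> hc; rewrite /config_output config_run_update. Qed.

Lemma measurable_hit kappa c l j : measurable (hit kappa c l j).
Proof.
pose Y := [set v : 'rV[R]_(@ncoord n D) |
  block_dist2 Delta v j (kappa j) < Delta j ^+ 2 / 2].
have mY : measurable Y.
  have := measurable_preimageT (measurable_block_dist2 Delta j (kappa j))
    (measurable_itv `]-oo, (Delta j ^+ 2 / 2)[).
  by congr (measurable _); apply/seteqP; split=> v /=; rewrite in_itv.
have mdec : forall k i, measurable_partial
    (fun q : seed M * k.-tuple 'rV[R]_(@ncoord n D) => decide q.1 0 q.2 i).
  exact: measurable_decide.
have msam i r : measurable_fun setT (config_sample kappa c i r).
  have := @measurable_oracle R _ (hess delta A i) (needle Delta kappa) (rescale p delta i).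
  by move=> /(measurable_fun_pair1 (nat_of_ord (c (i, inord r)))).
have [_ mr _ _] := measurable_iter_next_return
  (decision := fun u => decide u 0) tau mdec msam t l.2.
apply: (measurable_seq_preimage (F := fun u r => output l.1 u 0 r) (Y := Y) mr) => k.
exact: (measurable_preimageT (@measurable_output _ _ _ _ M 0 k l.1) mY).
Qed.

Definition hit_prob kappa c l j : R := fine (seed_law M (hit kappa c l j)).

(** The output is the same point for all [k], and it is close to at most one candidate block, so the
    events are disjoint. *)
Lemma sum_hit_prob_update kappa c l j : hidden j c ->
  \sum_k hit_prob (update kappa j k) c l j <= 1.
Proof.
move=> hc; apply: sum_probability_disjoint => [k|k k' u].
  exact: measurable_hit.
rewrite /hit /= !config_output_update// !ffunE eqxx => hk hk'.
apply/eqP/negPn/negP => /(block_dist2_far Delta (config_output kappa c l u) j).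
lra.
Qed.

(** The weight of the hidden configurations factors over the samples, and [ge1B_prod] acts as a
    union bound over the samples that could show block [j]. *)
Lemma sum_config_weight j : 
  1 - (\sum_i (max_returns i)%:R * delta + (max_returns j)%:R * p j) <=
  \sum_(c | hidden j c) config_weight c.
Proof.
have := bigA_distr_big_dep (fun ik : 'I_n * 'I_total_returns.+1 => [pred x : 'I_3 |
    (ik.2 < max_returns ik.1)%N ==> (x < if ik.1 == j then 1 else 2)%N])
    (fun ik x => reveal_weight (p ik.1) delta x) => <-.
have w1 (i : 'I_n) : \sum_(x < 3) reveal_weight (p i) delta x = 1.
  exact: sum_reveal_weight.
have w0 (i : 'I_n) x : 0 <= reveal_weight (p i) delta x.
  exact: reveal_weight_ge0.
have d0 : 0 <= delta by case/andP: delta01 => /ltW.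
(* This bounds the probability that one sample shows block [j]; samples beyond [max_returns] are
   unconstrained and cost 0. *)
pose F (ik : 'I_n * 'I_total_returns.+1) : R :=
  if (ik.2 < max_returns ik.1)%N then delta + (if ik.1 == j then p j else 0) else 0.
apply: le_trans (ge1B_prod _) => [|[i k]]; last first.
  apply/andP; split; first by apply: sumr_ge0.
  by rewrite -(w1 i) big_mkcond/=; apply: ler_sum => x _; case: ifP.
rewrite lerD2l lerN2; apply: (@le_trans _ _ (\sum_ik F ik)).
  apply: ler_sum => -[i k] _; rewrite /F /= big_mkcond !big_ord_recl big_ord0 /=.
  have := mulr_ge0 (proj1 (andP (p01 i))) d0.
  case: (_ < _)%N => /=; last by move=> _; rewrite /reveal_weight; lra.
  case: eqP => [->|_] /=; rewrite /reveal_weight; first by case/andP: (p01 j); nra.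
  lra.
rewrite -(pair_bigA _ (fun i k => F (i, k)))/=.
rewrite [X in _ + X](_ : _ = \sum_i (max_returns i)%:R * (if i == j then p j else 0)).
  rewrite -big_split/=; apply: ler_sum => i _; rewrite -mulrDr /F /= -big_mkcond/=.
  have Ki : (max_returns i <= total_returns.+1)%N.
    by rewrite /total_returns (bigD1 i)//= -addnS leq_addr.
  by rewrite (big_ord_narrow Ki) sumr_const card_ord mulr_natl.
rewrite (bigD1 j)//= eqxx big1 ?addr0// => i /negbTE ->.
by rewrite mulr0.
Qed.

Definition miss kappa c j : set (seed M) := [set u | forall l, ~ hit kappa c l j u].

Lemma measurable_miss kappa c j : measurable (miss kappa c j).
Proof.
rewrite (_ : miss kappa c j = ~` (\big[setU/set0]_l hit kappa c l j)).
  by apply/measurableC/bigsetU_measurable => l _; exact: measurable_hit.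
apply/seteqP; split=> u /=; rewrite -bigcup_seq /=.
  by move=> mu [l _]; exact: mu.
by move=> mu l hl; apply: mu; exists l => //=; exact: mem_index_enum.
Qed.

Section randomness.
Context (dO : measure_display) (Omega : measurableType dO) (P : probability Omega R).
Variables (U : {RV P >-> seed M}) (xi : 'I_n -> nat -> {RV P >-> nat}).
Hypothesis Uxi : independent_randomness (seed_law M) (noise p01 delta01) U xi.

Definition sampled (c : config) : set Omega :=
  [set w | forall i (k : 'I_total_returns.+1), xi i k w = val (c (i, k))].

Lemma probability_miss kappa c j :
  P ((U @^-1` miss kappa c j) `&` sampled c) =
  (seed_law M (miss kappa c j) * (config_weight c)%:E)%E.
Proof.
have := Uxi (B := fun i k => [set val (c (i, k))]) (measurable_miss kappa c j).
move=> -> //; congr (_ * _)%E; rewrite /config_weight.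
rewrite (eq_bigr (fun ik => reveal_weight (p ik.1) delta (c (ik.1, ik.2))));
  last by case.
rewrite -(pair_bigA _ (fun i k => reveal_weight (p i) delta (c (i, k))))/=.
rewrite -prodEFin; apply: eq_bigr => i _; rewrite -prodEFin; apply: eq_bigr => k _.
exact: noise_set1.
Qed.

Lemma measurable_miss_sampled kappa c j :
  measurable ((U @^-1` miss kappa c j) `&` sampled c).
Proof.
apply: measurableI.
  exact: (measurable_preimageT (measurable_funPT U) (measurable_miss kappa c j)).
rewrite (_ : sampled c = \big[setI/setT]_i \big[setI/setT]_(k < total_returns.+1)
    (xi i k @^-1` [set val (c (i, k))])).
  apply: bigsetI_measurable => i _; apply: bigsetI_measurable => k _.
  exact: (measurable_preimageT (measurable_funPT (xi i k))).
apply/seteqP; split=> w /=; rewrite -bigcap_seq /=.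
  by move=> sw i _ /=; rewrite -bigcap_seq => k _ /=; exact: sw.
move=> sw i k; have := sw i (mem_index_enum i); rewrite /= -bigcap_seq.
by move=> /(_ k (mem_index_enum k)).
Qed.

Lemma output_at_sampled kappa c w q T : T <= t -> sampled c w ->
  exists l, output_at tau M (sgrad Delta p delta A kappa) 0 (U w)
    (fun i k => xi i k w) q T = config_output kappa c (q, l) (U w).
Proof.
move=> Tt sw; rewrite /output_at /config_output /=.
have [l lN ->] := returned_by_iter (decide (U w) 0)
  (fun i k x => sgrad Delta p delta A kappa i x (xi i k w)) tau_gt0 Tt.
exists (Ordinal (lN : (l < total_returns.+1)%N)); congr (output _ _ _ (returned _)).
apply: eq_iter_next_return => // i r x ri; rewrite /config_sample.
have rN := max_returns_lt ri.
by have := sw i (inord r); rewrite inordK// => ->.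
Qed.

(** When the samples form a configuration hiding block [j] and the seed misses with every candidate,
    block [j] alone contributes at least [Delta j ^+ 2 / 2]. For fixed [j] these events are disjoint
    in the configuration. Independence gives their probabilities, and a union bound over the
    candidates handles the seed. *)
Lemma expectation_dist2_ge kappa q T : T <= t ->
  ((\sum_j Delta j ^+ 2 / 2 * \sum_(c | hidden j c)
      config_weight c * (1 - \sum_l hit_prob kappa c l j))%:E <=
   'E_P[fun w => (norm2 (output_at tau M (sgrad Delta p delta A kappa) 0 (U w)
      (fun i k => xi i k w) q T - needle Delta kappa) ^+ 2)%R])%E.
Proof.
move=> Tt; rewrite expectation.unlock.
pose E (jc : 'I_n * config) := (U @^-1` miss kappa jc.2 jc.1) `&` sampled jc.2.
pose alpha (jc : 'I_n * config) : R :=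
  if hidden jc.1 jc.2 then Delta jc.1 ^+ 2 / 2 else 0.
have alpha0 jc : 0 <= alpha jc.
  by rewrite /alpha; case: ifP => // _; rewrite divr_ge0 ?sqr_ge0.
have cw0 c : 0 <= config_weight c.
  by apply: prodr_ge0 => ik _; exact: reveal_weight_ge0.
apply: le_trans (@le_expectation_indic _ _ _ P _ alpha E _ alpha0 _ _)
  => [|[j c]|w]; last 2 first.
- exact: measurable_miss_sampled.
- rewrite sqr_norm2_needle -(pair_bigA _ (fun j c => alpha (j, c) * \1_(E (j, c)) w))/=.
  apply: ler_sum => j _.
  have [/existsP[c /asboolP[mc sc]]|/existsPn none] :=
      boolP [exists c, `[< E (j, c) w >]]; last first.
    rewrite big1 ?block_dist2_ge0// => c _.
    rewrite indicE memNset ?mulr0// => Ec.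
    by move: (none c); rewrite asboolT.
  rewrite (bigD1 c)//= big1 => [|c' c'c].
    rewrite addr0 indicE mem_set// mulr1 /alpha; case: ifP => _; last exact: block_dist2_ge0.
    have [l ->] := output_at_sampled kappa q Tt sc.
    by rewrite leNgt; apply/negP; exact: mc.
  rewrite indicE memNset ?mulr0// => -[_ sc']; move/eqP: c'c; apply.
  by apply/ffunP => -[i k]; apply/val_inj; rewrite -sc -sc'.
rewrite -(pair_bigA _ (fun j c => (alpha (j, c))%:E * P (E (j, c)))%E)/=.
rewrite -sumEFin; apply: lee_sum => j _.
rewrite mulr_sumr big_mkcond/= -sumEFin; apply: lee_sum => c _.
rewrite /alpha/=; case: ifP => _; last by rewrite mul0e.
rewrite probability_miss -fine_probability; last exact: measurable_miss.
rewrite -!EFinM lee_fin ler_wpM2l ?divr_ge0 ?sqr_ge0// mulrC ler_wpM2r//.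
apply: union_bound => [l| |u mu]; [exact: measurable_hit|exact: measurable_miss|].
by apply: contrapT => /forallNP.
Qed.

End randomness.

Lemma exists_hard_needle (beta : R) : (0 < D)%N -> (m * total_returns.+1 <= D)%N ->
  (forall j, \sum_i (max_returns i)%:R * delta + (max_returns j)%:R * p j <= 1 - beta) ->
  exists kappa, (\sum_j Delta j ^+ 2 / 2) * beta * (1 - (m * total_returns.+1)%:R / D%:R) <=
    \sum_j Delta j ^+ 2 / 2 * \sum_(c | hidden j c)
      config_weight c * (1 - \sum_l hit_prob kappa c l j).
Proof.
move=> D0 mD bound.
have card : #|{: candidate}| = (m * total_returns.+1)%N by rewrite card_prod !card_ord.
rewrite -card; apply: exists_above_average => //.
- by rewrite card.
- by move=> j; rewrite divr_ge0 ?sqr_ge0.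
- by move=> c; apply: prodr_ge0 => ik _; exact: reveal_weight_ge0.
- move=> j; apply: le_trans (sum_config_weight j).
  by have := bound j; lra.
- by move=> j c l kappa; exact: sum_hit_prob_update.
Qed.

End lower_bound.

(** * Choice of the parameters and conclusion *)

(** If the minimum is 1, the own block is always shown and the variance is 0. Otherwise
    [reveal_prob] is at least [x], and [a * s / x] equals [sigma2 / 2]. *)
Lemma reveal_prob_variance (R : realType) (a s sigma2 delta : R) :
  0 < a -> 0 < s -> 0 < sigma2 -> 0 < delta < 1 ->
  a * ((reveal_prob (Num.min 1 (2 * a * s / sigma2)) delta)^-1 - 1) * s <= sigma2 / 2.
Proof.
move=> a0 s0 g0 d01; set x := 2 * a * s / sigma2.
have x0 : 0 < x by rewrite /x divr_gt0// !mulr_gt0.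
have [x1|x1] := leP 1 x.
  rewrite (_ : reveal_prob 1 delta = 1) ?invr1; last by rewrite /reveal_prob; ring.
  by rewrite subrr mulr0 mul0r divr_ge0// ltW.
have Px : x <= reveal_prob x delta.
  case/andP: d01 => d0 _; rewrite /reveal_prob.
  have : 0 <= delta * (1 - x) by rewrite mulr_ge0 ?subr_ge0// ltW.
  lra.
have -> : sigma2 / 2 = a * x^-1 * s.
  by rewrite /x; field; rewrite !gt_eqF.
rewrite ler_pM2r// ler_pM2l// lerBlDr (le_trans (y := x^-1))//; last by rewrite lerDl.
by rewrite lef_pV2// ?posrE// (lt_le_trans x0).
Qed.

Lemma truncn_reveal_bound (R : realType) (t tau a s : R) : 0 < tau -> 0 <= s -> 0 <= a ->
  t * s <= a * tau -> (Num.truncn (t / tau))%:R * s <= a.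
Proof.
move=> tau0 s0 a0 ts; have [t0|t0] := leP 0 t; last first.
  have -> : Num.truncn (t / tau) = 0%N; last by rewrite mul0r.
  apply/truncn0Pn; rewrite -ltNge ltr_pdivrMr// mul1r.
  exact: lt_trans tau0.
rewrite -(ler_pM2r tau0) (le_trans _ ts)// mulrAC ler_wpM2r//.
by rewrite -ler_pdivlMr// truncn_le divr_ge0// ltW.
Qed.

Lemma exists_small (R : realFieldType) (a b c e : R) :
  0 < a -> 0 < b -> 0 < c -> 0 < e ->
  exists2 x, 0 < x & [/\ x <= a, x <= b, x <= c & x <= e].
Proof.
move=> a0 b0 c0 e0; exists (Num.min (Num.min a b) (Num.min c e)).
  by rewrite !lt_min a0 b0 c0 e0.
by split; rewrite !ge_min lexx ?orbT.
Qed.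

Theorem theorem3p7 (R : realType) :
  exists c0 : R, 0 < c0 /\
  forall (n : nat) (tau : 'I_n -> R) (m : nat)
    (M : forall d : nat, randomized_method R n m d)
    (eps Lmax rad mu sigma2 t : R),
  (2 <= n)%N ->
  (forall i, 0 < tau i) ->
  (forall i j : 'I_n, (i <= j)%N -> tau i <= tau j) ->
  0 < eps -> 0 < Lmax -> 0 < rad -> 0 < mu -> 0 < sigma2 ->
  mu < Lmax / (2 * n%:R) -> eps < 1 / 100 -> 10 < rad ->
  t <= c0 * (n%:R^-1 * \sum_(i < n) tau i) * (sigma2 / (eps * n%:R * mu ^+ 2)) ->
  exists (d : nat) (f : 'I_n -> 'rV[R]_d -> R)
    (dX : measure_display) (X : measurableType dX) (D : 'I_n -> probability X R)
    (g : 'I_n -> 'rV[R]_d -> X -> 'rV[R]_d) (x0 : 'rV[R]_d),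
  (exists z, closest_minimizer (average f) x0 z /\ norm2 (x0 - z) <= rad) /\
  (forall i, measurable_fun setT (fun p : 'rV[R]_d * X => g i p.1 p.2)) /\
  (forall i, smooth Lmax (f i) /\ convex_function setT (f i)) /\
  (exists z, minimizer (average f) z) /\
  (forall i x, minimizer (average f) x <-> minimizer (f i) x) /\
  smooth Lmax (average f) /\ PL mu (average f) /\
  unbiased f D g /\ variance_bounded f D g sigma2 /\
  (forall (dO : measure_display) (Omega : measurableType dO)
     (P : probability Omega R) (U : {RV P >-> seed (M d)})
     (xi : 'I_n -> nat -> {RV P >-> X}),
   independent_randomness (seed_law (M d)) D U xi ->
   forall (q : 'I_m) (T : R), 0 <= T <= t ->
   (eps%:E < 'E_P[fun w =>
      let xbar := output_at tau (M d) g x0 (U w) (fun i k => xi i k w) q T in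
      (norm2 (xbar - proj_minimizer (average f) xbar) ^+ 2)%R])%E).
Proof.
(* With [p j <= 2 * A ^+ 2 * s j / sigma2], the time bound yields [max_returns * p j <= 8 * c0],
   which has to be at most 1/8. *)
exists (1 / 64); split; first by lra.
move=> n tau m M eps Lmax rad mu sigma2 t n2 tau0 _ eps0 Lmax0 rad0 mu0 sigma20
  muL eps1 rad10 tbound.
have n0 : (0 < n)%N by exact: leq_trans n2.
have n0' : 0 < n%:R :> R by rewrite ltr0n.
set S := \sum_(i < n) tau i in tbound.
have S0 : 0 < S.
  by rewrite /S; case: n n0 tau tau0 {M n2 n0' muL tbound S} => // n _ tau tau0;
    rewrite big_ord_recl ltr_pwDl// sumr_ge0// => i _; exact: ltW.
pose s i := 4 * eps * tau i / S.
have s0 i : 0 < s i by rewrite /s divr_gt0// !mulr_gt0.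
pose Delta i := Num.sqrt (s i).
have Delta2 i : Delta i ^+ 2 = s i by rewrite /Delta sqr_sqrtr// ltW.
have sumDelta : \sum_i Delta i ^+ 2 = 4 * eps.
  rewrite (eq_bigr s) => [|i _]; last exact: Delta2.
  by rewrite -mulr_suml -mulr_sumr -/S mulfK// gt_eqF.
pose A := n%:R * mu.
have A0 : 0 < A by rewrite mulr_gt0.
have AL : A <= Lmax.
  move: muL; rewrite ltr_pdivlMr ?mulr_gt0// => muL.
  by rewrite /A; nra.
pose p i := Num.min 1 (2 * A ^+ 2 * s i / sigma2).
have ps0 i : 0 < 2 * A ^+ 2 * s i / sigma2.
  by rewrite divr_gt0// mulr_gt0// mulr_gt0// exprn_gt0.
have p01 i : 0 <= p i <= 1 by rewrite /p le_min ler01 ltW//= ge_min lexx.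
pose N := total_returns tau t.
(* Neither [m] nor [N] depends on the dimension, so there is no circularity. The successor keeps [D]
   positive when [m] is 0. *)
pose D := (8 * (m * N.+1)).+1.
(* The four bounds give, in order, [delta <= A], [delta < 1], a variance of at most [sigma2 / 2]
   from the foreign blocks, and [N * delta <= 1 / 8]. *)
have [|||delta d0 [dA d12 dsig dN]] := @exists_small R A (1/2) (sigma2 / (8 * eps))
   (1 / (8 * N.+1%:R)) A0.
- by [].
- by rewrite divr_gt0// mulr_gt0.
- by rewrite divr_gt0// mulr_gt0.
have d01 : 0 < delta < 1 by rewrite d0/=; lra.
have hess0 i (b : 'I_(@ncoord n D)) : 0 < hess delta A i b by exact: hess_gt0.
have [|||kappa hard] := @exists_hard_needle R n D m Delta p delta A p01 d01 tau t
  (M (@ncoord n D)) tau0 (3 / 4).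
- by [].
- by rewrite /D leqW// leq_pmull.
- move=> j; rewrite -mulr_suml -natr_sum -/(total_returns tau t) -/N.
  have hN : N%:R * delta <= 1 / 8.
    move: dN; rewrite ler_pdivlMr ?mulr_gt0// -[N.+1%:R]natr1 => dN.
    by lra.
  have hj : (max_returns tau t j)%:R * p j <= 1 / 8.
    apply: (@le_trans _ _ ((max_returns tau t j)%:R * (2 * A ^+ 2 * s j / sigma2))).
      by rewrite ler_wpM2l// /p ge_min lexx orbT.
    apply: truncn_reveal_bound => //; first exact: ltW.
    have := ler_wpM2r (ltW (ps0 j)) tbound; congr (_ <= _).
    by rewrite /s /A; field; rewrite !gt_eqF.
  lra.
exists (@ncoord n D), (loss Delta delta A kappa), _, nat, (noise p01 d01),
  (sgrad Delta p delta A kappa), 0.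
pose h := @avg_hess R n delta A.
have avgE : average (loss Delta delta A kappa) = quad (fun=> h) (needle Delta kappa).
  exact: average_loss.
have hmu : mu <= h.
  have -> : h = mu + delta * (1 - n%:R^-1).
    by rewrite /h /avg_hess /A; field; rewrite gt_eqF.
  by rewrite lerDl mulr_ge0 ?(ltW d0)// subr_ge0 invf_le1// ler1n.
have hA : h <= A.
  have : 0 <= (1 - n%:R^-1) * (A - delta).
    by rewrite mulr_ge0 ?subr_ge0// invf_le1// ler1n.
  by rewrite /h /avg_hess; lra.
have h0 : 0 < h by exact: lt_le_trans hmu.
rewrite avgE; split.
  exists (needle Delta kappa); split; first exact/closest_minimizer_quad.
  rewrite -(@ler_pXn2r _ 2)// ?nnegrE ?norm2_ge0 ?ltW// sqr_norm2.
  rewrite (eq_bigr (fun b => 1 * needle Delta kappa ord0 b ^+ 2)) => [|b _].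
    rewrite (sum_needle Delta (fun=> 1)).
    by under eq_bigr do rewrite mul1r; rewrite sumDelta; nra.
  by rewrite !mxE sub0r sqrrN mul1r.
split; first by move=> i; exact: measurable_oracle.
split.
  move=> i; split.
    by apply: smooth_quad => b; rewrite ltW//= (le_trans _ AL)// hess_le.
  by apply: convex_quad => b; exact: ltW.
split; first by exists (needle Delta kappa); exact/minimizer_quad.
split.
  by move=> i x; split=> /minimizer_quad -> //; exact/minimizer_quad.
split; first by apply: smooth_quad => b; rewrite ltW//= (le_trans hA).
split; first exact: PL_quad.
split; first exact: unbiased_sgrad.
split.
  apply: variance_bounded_sgrad => [i|].
    by rewrite Delta2; apply: reveal_prob_variance => //; exact: exprn_gt0.
  rewrite sumDelta; move: dsig; rewrite ler_pdivlMr ?mulr_gt0//.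
  by lra.
move=> dO Omega P U xi Uxi q T /andP[_ Tt].
under [fun w => _]eq_fun do rewrite /= proj_minimizer_quad//.
apply: lt_le_trans (expectation_dist2_ge Delta A tau0 Uxi kappa q Tt).
rewrite lte_fin (lt_le_trans _ hard)//.
rewrite -mulr_suml sumDelta.
have mD : (m * N.+1)%:R / D%:R <= 1 / 8 :> R.
  rewrite ler_pdivrMr ?ltr0n//.
  have -> : D%:R = 8 * (m * N.+1)%:R + 1 :> R by rewrite /D -[in LHS]natr1 natrM.
  lra.
(* The bound obtained is at least [2 * eps * (3 / 4) * (7 / 8)], that is [21 / 16 * eps], which
   exceeds [eps]. *)
have : 0 <= eps * (1 / 8 - (m * N.+1)%:R / D%:R) by rewrite mulr_ge0 ?(ltW eps0)// subr_ge0.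
by rewrite -/N; lra.
Qed.
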